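(* The Bernstein isomorphism of $\mathbb{Z}[\mathbf{q}]$-algebras $$\mathscr{B}(\mathbf{q}):\mathcal{A}(\mathbf{q})\xrightarrow{\ \sim\ }\mathbb{Z}[V_{\widehat{\mathbf{T}}\subset\widehat{\mathbf{G}},\rho_{\mathrm{ad}}}],\qquad E(\nu)\longmapsto(e_1^{\nu}\otimes e_2^{-\nu_-})|_{\rho_{\mathrm{ad}}}$$ is $W$-equivariant. In particular, it induces an isomorphism $$\mathscr{B}(\mathbf{q})^W:\mathcal{A}(\mathbf{q})^W\xrightarrow{\ \sim\ }\mathbb{Z}[V_{\widehat{\mathbf{T}}\subset\widehat{\mathbf{G}},\rho_{\mathrm{ad}}}]^W.$$
   Context: **Dual side.** $\widehat{\mathbf{G}}$ is a split connected reductive group scheme over $\mathbb{Z}$, $\widehat{\mathbf{T}}\subset\widehat{\mathbf{B}}\subset\widehat{\mathbf{G}}$ a split maximal torus and a Borel subgroup, $W$ the Weyl group, $\widehat{\mathbf{T}}_{\mathrm{ad}}=\widehat{\mathbf{T}}/Z_{\widehat{\mathbf{G}}}$; $X^*(\widehat{\mathbf{T}}_{\mathrm{ad}})\subset X^*(\widehat{\mathbf{T}})$ is the root lattice and $X^*(\widehat{\mathbf{T}}_{\mathrm{ad}})_{\mathrm{pos}}$ its submonoid generated by the positive roots. For $\nu\in X^*(\widehat{\mathbf{T}})$, $\nu_-$ is the unique antidominant $W$-conjugate of $\nu$. $V_{\widehat{\mathbf{T}}\subset\widehat{\mathbf{G}}}$ is the toral submonoid of the Vinberg monoid of $\widehat{\mathbf{G}}$;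 explicitly its ring of functions is the subring of $\mathbb{Z}[\widehat{\mathbf{T}}]\otimes\mathbb{Z}[\widehat{\mathbf{T}}]$ $$\mathbb{Z}[V_{\widehat{\mathbf{T}}\subset\widehat{\mathbf{G}}}]=\bigoplus_{\nu_1,\nu_2\in X^*(\widehat{\mathbf{T}}),\ \nu_2+(\nu_1)_-\in X^*(\widehat{\mathbf{T}}_{\mathrm{ad}})_{\mathrm{pos}}}\mathbb{Z}\,(e_1^{\nu_1}\otimes e_2^{\nu_2}),$$ an algebra over $\mathbb{Z}[X^*(\widehat{\mathbf{T}}_{\mathrm{ad}})_{\mathrm{pos}}]$ via $\bar e^{\mu}\mapsto1\otimes e_2^{\mu}$. $\rho_{\mathrm{ad}}$ is the sum of the fundamental coweights of the adjoint group of $\widehat{\mathbf{G}}$, and $V_{\widehat{\mathbf{T}}\subset\widehat{\mathbf{G}},\rho_{\mathrm{ad}}}$ is the base change to $\mathbb{A}^1=\mathrm{Spec}\,\mathbb{Z}[\mathbf{q}]$ along $\bar e^{\mu}\mapsto\mathbf{q}^{\langle\mu,\rho_{\mathrm{ad}}\rangle}$. The image of $e_1^{\nu_1}\otimes e_2^{\nu_2}$ is written $(e_1^{\nu_1}\otimes e_2^{\nu_2})|_{\rho_{\mathrm{ad}}}$. The group $W$ acts on $V_{\widehat{\mathbf{T}}\subset\widehat{\mathbf{G}}}$ (through conjugation by the normalizer of $\widehat{\mathbf{T}}$ in the Vinberg monoid), on functions by $w(e_1^{\nu_1}\otimes e_2^{\nu_2})=e_1^{w(\nu_1)}\otimes e_2^{\nu_2}$,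 and by base change on $V_{\widehat{\mathbf{T}}\subset\widehat{\mathbf{G}},\rho_{\mathrm{ad}}}$ over $\mathbb{A}^1$. **Hecke side.** $\mathbf{T}\subset\mathbf{G}$ are dual to $\widehat{\mathbf{T}}\subset\widehat{\mathbf{G}}$, so $X_*(\mathbf{T})=X^*(\widehat{\mathbf{T}})$; $F/\mathbb{Q}_p$ is a finite extension, $\mathbf{N}$ the normalizer of $\mathbf{T}$ in $\mathbf{G}$, $\widetilde W=\mathbf{N}(F)/\mathbf{T}(o_F)$ the extended affine Weyl group with length $\ell$ (for $\nu\in X_*(\mathbf{T})$: $\ell(\nu)=\sum_{\alpha>0}|\langle\alpha,\nu\rangle|$) and simple affine reflections $S_{\mathrm{aff}}$. $\mathcal{H}(\mathbf{q})$ is the generic Iwahori Hecke algebra: free over $\mathbb{Z}[\mathbf{q}]$ on $T_w$, $w\in\widetilde W$, with $T_wT_{w'}=T_{ww'}$ if lengths add and $T_s^2=\mathbf{q}+(\mathbf{q}-1)T_s$ for $s\in S_{\mathrm{aff}}$. It has Vignéras' Bernstein basis $(E(w))_{w\in\widetilde W}$ (antidominant orientation), satisfying $E(e^\nu)E(w)=\mathbf{q}^{(\ell(\nu)+\ell(w)-\ell(e^\nu w))/2}E(e^\nu w)$. Write $E(\nu)=E(e^\nu)$; $\mathcal{A}(\mathbf{q})=\bigoplus_{\nu\in X_*(\mathbf{T})}\mathbb{Z}[\mathbf{q}]E(\nu)$ is a commutative subalgebra, on which $W$ acts $\mathbb{Z}[\mathbf{q}]$-linearly by $w(E(\nu))=E(w(\nu))$.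 *)

(* Defs.v *)
From HB Require Import structures.
From mathcomp Require Import all_boot all_order all_algebra finmap.
From mathcomp Require Import generic_quotient ring_quotient.
From mathcomp Require Import boolp classical_sets functions.
From mathcomp Require Import monalg.
From mathcomp Require Import zify ring lra.

Set Implicit Arguments.
Unset Strict Implicit.
Unset Printing Implicit Defensive.

Import Order.TTheory GRing.Theory Num.Theory.

Local Open Scope ring_scope.
Local Open Scope quotient_scope.

(* The ring Z[M] of a commutative monoid M written additively, on the free    *)
(* abelian group {malg int[M]}; mexp m is the basis element e^m.  The         *)
(* multiplication of {malg R[K]} itself is not usable, as monomType excludes  *)
(* monoids with nontrivial units.                                             *)
Section MonoidRing.
Variable M : nmodType.

Definition monoid_ring : Type := {malg int[M]}.
HB.instance Definition _ := GRing.Zmodule.copy monoid_ring {malg int[M]}.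

Definition mexp (m : M) : monoid_ring := << m >>.

(* The additive extension of F to Z[M]. *)
Definition mext (V : zmodType) (F : M -> V) (g : monoid_ring) : V :=
  \sum_(k <- msupp g) F k *~ g@_k.

Lemma mextEw (V : zmodType) (F : M -> V) (g : monoid_ring) (d : {fset M}) :
  (msupp g `<=` d)%fset -> mext F g = \sum_(k <- d) F k *~ g@_k.
Proof.
move=> le; rewrite /mext (big_fset_incl _ le) //= => k _.
by rewrite -mcoeff_eq0 => /eqP ->; rewrite mulr0z.
Qed.

Lemma mext_is_additive (V : zmodType) (F : M -> V) : zmod_morphism (mext F).
Proof.
move=> g1 g2.
set d := (msupp g1 `|` msupp g2)%fset.
rewrite (@mextEw _ F g1 d) ?fsubsetUl // (@mextEw _ F g2 d) ?fsubsetUr //.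
rewrite (@mextEw _ F (g1 - g2) d) ?msuppB_le // -sumrB; apply: eq_bigr => k _.
by rewrite mcoeffB mulrzBr.
Qed.
HB.instance Definition _ (V : zmodType) (F : M -> V) :=
  GRing.isZmodMorphism.Build monoid_ring V (mext F) (mext_is_additive F).

Lemma mext_mexp (V : zmodType) (F : M -> V) m : mext F (mexp m) = F m.
Proof. by rewrite (@mextEw _ F _ [fset m]%fset) ?msuppU_le // big_seq_fset1 mcoeffUU. Qed.

Lemma monoid_ringE (g : monoid_ring) : g = mext mexp g.
Proof.
rewrite [LHS](monalgE g) /mext; apply: eq_bigr => k _.
by rewrite /mexp -[in LHS](intz g@_k) -(raddfMz (mkmalgU k)).
Qed.

Lemma mext_unique (V : zmodType) (F G : monoid_ring -> V) :
  zmod_morphism F -> zmod_morphism G ->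
  (forall m, F (mexp m) = G (mexp m)) -> F =1 G.
Proof.
move=> Fm Gm FG g.
pose F' : {additive _ -> _} := HB.pack F (GRing.isZmodMorphism.Build _ _ F Fm).
pose G' : {additive _ -> _} := HB.pack G (GRing.isZmodMorphism.Build _ _ G Gm).
rewrite -[F]/(F' : _ -> _) -[G]/(G' : _ -> _).
rewrite (monoid_ringE g) /mext !raddf_sum; apply: eq_bigr => k _.
by rewrite !raddfMz /= FG.
Qed.

Definition mr_mul (g h : monoid_ring) : monoid_ring :=
  mext (fun k => mext (fun l => mexp (k + l)) h) g.

Lemma mr_mulBl h : zmod_morphism (mr_mul^~ h).
Proof. exact: mext_is_additive. Qed.
Lemma mr_mulBr g : zmod_morphism (mr_mul g).
Proof.
move=> h1 h2; rewrite /mr_mul /mext -sumrB; apply: eq_bigr => k _.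
by rewrite -/(mext _ _) mext_is_additive mulrzBl.
Qed.
Lemma mr_mul_mexp k l : mr_mul (mexp k) (mexp l) = mexp (k + l).
Proof. by rewrite /mr_mul !mext_mexp. Qed.

Lemma mr_mulC : commutative mr_mul.
Proof.
move=> g h; move: g.
apply: (mext_unique (mr_mulBl h) (mr_mulBr h)) => k; move: h.
apply: (mext_unique (mr_mulBr _) (mr_mulBl _)) => l.
by rewrite !mr_mul_mexp addrC.
Qed.

Lemma mr_mulA : associative mr_mul.
Proof.
move=> g h i; move: g; apply: mext_unique.
- exact: mr_mulBl.
- by move=> g1 g2; rewrite !mr_mulBl.
move=> k; move: h; apply: mext_unique.
- by move=> h1 h2; rewrite mr_mulBl mr_mulBr.
- by move=> h1 h2; rewrite mr_mulBr mr_mulBl.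
move=> l; move: i; apply: mext_unique.
- by move=> i1 i2; rewrite !mr_mulBr.
- exact: mr_mulBr.
by move=> m; rewrite !mr_mul_mexp addrA.
Qed.

Lemma mr_mul1 : left_id (mexp 0) mr_mul.
Proof.
apply: mext_unique => [|//|k]; first exact: mr_mulBr.
by rewrite mr_mul_mexp add0r.
Qed.

Lemma mr_mulDl : left_distributive mr_mul +%R.
Proof.
move=> g h i; have := mr_mulBl i (g + h) h; rewrite /= addrK => ->.
by rewrite subrK.
Qed.

Lemma mr_1neq0 : mexp 0 != 0.
Proof. by rewrite /mexp monalgU_eq0 oner_eq0. Qed.

HB.instance Definition _ := GRing.Zmodule_isComNzRing.Build monoid_ring
  mr_mulA mr_mulC mr_mul1 mr_mulDl mr_1neq0.

Lemma mexp0 : mexp 0 = 1. Proof. by []. Qed.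
Lemma mexpD k l : mexp (k + l) = mexp k * mexp l.
Proof. exact/esym/mr_mul_mexp. Qed.

Section Lift.
Variables (R : comNzRingType) (F : M -> R).
Hypotheses (F0 : F 0 = 1) (FD : forall k l, F (k + l) = F k * F l).
Lemma mext_is_multiplicative : monoid_morphism (mext F).
Proof.
split; first by rewrite -mexp0 mext_mexp.
move=> g h; move: g; apply: mext_unique.
- by move=> g1 g2; rewrite mulrBl raddfB.
- by move=> g1 g2; rewrite raddfB mulrBl.
move=> k; move: h; apply: mext_unique.
- by move=> h1 h2; rewrite mulrBr raddfB.
- by move=> h1 h2; rewrite raddfB mulrBr.
by move=> l; rewrite -mexpD !mext_mexp FD.
Qed.
End Lift.
End MonoidRing.

(* Base change of the A-algebra B along g : A -> Z[q], presented as           *)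
(* B (x)_A Z[q] = B[q] / (f a - g a, a in A); the indeterminate 'X is q.        *)
Section BaseChange.
Variables (A B : comNzRingType).
Variables (f : {rmorphism A -> B}) (g : {rmorphism A -> {poly int}}).

Definition bc_relator (a : A) : {poly B} := (f a)%:P - map_poly intr (g a).

Definition bc_ideal : pred {poly B} := fun x =>
  `[< exists s : seq ({poly B} * A), x = \sum_(p <- s) p.1 * bc_relator p.2 >].

Lemma bc_ideal_zmod : zmod_closed bc_ideal.
Proof.
split; first by apply/asboolP; exists [::]; rewrite big_nil.
move=> x y /asboolP[s ->] /asboolP[t ->]; apply/asboolP.
exists (s ++ [seq (- p.1, p.2) | p <- t]).
rewrite big_cat big_map /= -sumrN; congr (_ + _).
by apply: eq_bigr => p _; rewrite mulNr.
Qed.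

Lemma bc_idealM a x : x \in bc_ideal -> a * x \in bc_ideal.
Proof.
move=> /asboolP[s ->]; apply/asboolP.
exists [seq (a * p.1, p.2) | p <- s].
by rewrite big_map big_distrr /=; apply: eq_bigr => p _; rewrite mulrA.
Qed.

Lemma bc_ideal_rmorph (R : nzRingType) (chi : {rmorphism {poly B} -> R}) :
  (forall a, chi (f a)%:P = chi (map_poly intr (g a))) ->
  forall x, x \in bc_ideal -> chi x = 0.
Proof.
move=> chiE x /asboolP[s ->]; rewrite raddf_sum big1 // => p _.
apply: etrans (rmorphM chi _ _) _.
have -> : chi (bc_relator p.2) = 0; last by rewrite mulr0.
by apply: etrans (raddfB chi _ _) _; apply/eqP; rewrite subr_eq0; apply/eqP; exact: chiE.
Qed.
End BaseChange.

(* A split connected reductive group scheme over Z with T c B, given by its   *)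
(* based root datum: wt = X^*(T), cowt = X_*(T), roots, coroots and the       *)
(* simple roots attached to B.  Outside root_seq, coroot is irrelevant.  The  *)
(* dual group G over F has X_*(T_G) = wt, its roots are the coroots below and *)
(* its coroots are the roots below.                                           *)
Record based_root_datum : Type := BasedRootDatum {
  wt : zmodType;
  cowt : zmodType;
  pairing : wt -> cowt -> int;
  pairBl : forall y, zmod_morphism (pairing^~ y);
  pairBr : forall x, zmod_morphism (pairing x);
  pair_perfect : exists (n : nat) (e : 'I_n -> wt) (e' : 'I_n -> cowt),
    [/\ forall i j, pairing (e i) (e' j) = (i == j)%:R,
        forall x, x = \sum_i e i *~ pairing x (e' i) &
        forall y, y = \sum_i e' i *~ pairing (e i) y];
  root_seq : seq wt;
  coroot : wt -> cowt;
  root_seq_uniq : uniq root_seq;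
  coroot_inj : {in root_seq &, injective coroot};
  pair_coroot : {in root_seq, forall a, pairing a (coroot a) = 2};
  root_refl : {in root_seq &, forall a b, b - a *~ pairing b (coroot a) \in root_seq};
  coroot_refl : {in root_seq &, forall a b,
    coroot (b - a *~ pairing b (coroot a)) = coroot b - coroot a *~ pairing a (coroot b)};
  root_reduced : {in root_seq &, forall a b (m n : int),
    m != 0 -> a *~ m = b *~ n -> a = b \/ a = - b};
  ssrank : nat;
  simple_root : 'I_ssrank -> wt;
  simple_root_in : forall i, simple_root i \in root_seq;
  simple_free : forall c : 'I_ssrank -> int,
    \sum_i simple_root i *~ c i = 0 -> forall i, c i = 0;
  simple_base : {in root_seq, forall a, exists c : 'I_ssrank -> nat,
    a = \sum_i simple_root i *+ c i \/ a = - \sum_i simple_root i *+ c i}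
}.

Lemma zmod_morphism_mulrz (U V : zmodType) (F : U -> V) (x : U) (n : int) :
  zmod_morphism F -> F (x *~ n) = F x *~ n.
Proof.
move=> Fm.
pose F' : {additive U -> V} := HB.pack F (GRing.isZmodMorphism.Build _ _ F Fm).
exact: (raddfMz F').
Qed.

Lemma zmod_morphism_sum (U V : zmodType) (F : U -> V) (I : Type) (r : seq I)
    (G : I -> U) :
  zmod_morphism F -> F (\sum_(i <- r) G i) = \sum_(i <- r) F (G i).
Proof.
move=> Fm.
pose F' : {additive U -> V} := HB.pack F (GRing.isZmodMorphism.Build _ _ F Fm).
exact: (raddf_sum F').
Qed.

Section RootDatum.
Variable D : based_root_datum.
Local Notation X := (wt D).
Local Notation alpha := (@simple_root D).
Implicit Types (a b x y nu mu : X) (i j : 'I_(ssrank D)).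

Lemma pairDl x y (z : cowt D) : pairing (x + y) z = pairing x z + pairing y z.
Proof. by rewrite -[in RHS](addrK y x) (pairBl z (x + y) y) subrK. Qed.
Lemma pair0l (z : cowt D) : pairing 0 z = 0.
Proof. by rewrite -(subrr 0) (pairBl z) subrr. Qed.
Lemma pairNl x (z : cowt D) : pairing (- x) z = - pairing x z.
Proof. by rewrite -[- x]add0r (pairBl z) pair0l add0r. Qed.
Lemma pairNr x (z : cowt D) : pairing x (- z) = - pairing x z.
Proof. by rewrite -[- z]add0r (pairBr x) -(subrr 0) (pairBr x) subrr sub0r. Qed.
Lemma pairMzl x n (z : cowt D) : pairing (x *~ n) z = pairing x z * n.
Proof. by rewrite (zmod_morphism_mulrz _ _ (@pairBl D z)) -mulrzz. Qed.
Lemma pairMzr x n (z : cowt D) : pairing x (z *~ n) = pairing x z * n.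
Proof. by rewrite (zmod_morphism_mulrz _ _ (@pairBr D x)) -mulrzz. Qed.

Definition refl a x := x - a *~ pairing x (coroot a).

Lemma refl_is_additive a : zmod_morphism (refl a).
Proof.
move=> x y; rewrite /refl (pairBl _ x y) mulrzBr !opprB -!addrA; congr (_ + _).
by rewrite addrCA [RHS]addrC -addrA; congr (_ + _); rewrite addrC.
Qed.
HB.instance Definition _ a :=
  GRing.isZmodMorphism.Build X X (refl a) (refl_is_additive a).

Lemma reflK a : a \in root_seq D -> involutive (refl a).
Proof.
move=> ra x; rewrite /refl (pairBl _ x) pairMzl pair_coroot // -addrA -opprD -mulrzDr.
set n := pairing x _; have -> : n + (n - 2 * n) = 0 by ring.
by rewrite mulr0z subr0.
Qed.

Lemma refl_id a : a \in root_seq D -> refl a a = - a.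
Proof.
move=> ra; rewrite /refl pair_coroot // -[2]/(1 + 1)%R mulrzDr.
by rewrite opprD addNKr.
Qed.

Lemma rootN a : a \in root_seq D -> - a \in root_seq D.
Proof. by move=> ra; rewrite -refl_id // root_refl. Qed.

Lemma corootN a : a \in root_seq D -> coroot (- a) = - coroot a.
Proof.
move=> ra; rewrite -refl_id // /refl coroot_refl // pair_coroot //.
by rewrite -[2]/(1 + 1)%R mulrzDr opprD addNKr.
Qed.

Lemma pair_refl a b x : a \in root_seq D -> b \in root_seq D ->
  pairing (refl a x) (coroot (refl a b)) = pairing x (coroot b).
Proof.
move=> ra rb; rewrite {2}/refl coroot_refl // pairBr pairMzr /refl !pairBl !pairMzl.
by rewrite pair_coroot //; ring.
Qed.

(* x is a combination of simple roots with coefficients in nat; a root is     *)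
(* positive iff it satisfies in_cone.                                         *)
Definition in_cone x :=
  `[< exists c : 'I_(ssrank D) -> nat, x = \sum_i alpha i *+ c i >].

Lemma cone0 : in_cone 0.
Proof. by apply/asboolP; exists (fun=> 0%N); rewrite big1. Qed.
Lemma coneD x y : in_cone x -> in_cone y -> in_cone (x + y).
Proof.
move=> /asboolP[c ->] /asboolP[d ->]; apply/asboolP; exists (fun i => c i + d i)%N.
by rewrite -big_split; apply: eq_bigr => i _; rewrite mulrnDr.
Qed.
Lemma coneMn x n : in_cone x -> in_cone (x *+ n).
Proof. by move=> px; elim: n => [|n IH]; rewrite ?cone0 // mulrS coneD. Qed.
Lemma cone_anti x : in_cone x -> in_cone (- x) -> x = 0.
Proof.
move=> /asboolP[c xE] /asboolP[d xNE].
have : \sum_i alpha i *~ (c i + d i)%N%:Z = 0.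
  rewrite -[RHS](subrr x) {1}xE xNE -big_split; apply: eq_bigr => i _ /=.
  by rewrite -mulrnDr pmulrn.
move=> /simple_free cd; rewrite xE big1 // => i _.
by have := cd i; case: (c i).
Qed.
Lemma cone_simple i : in_cone (alpha i).
Proof.
apply/asboolP; exists (fun j => (j == i) : nat).
by rewrite (bigD1 i) //= eqxx mulr1n big1 ?addr0 // => j /negPf ->; rewrite mulr0n.
Qed.

Lemma root_neq0 a : a \in root_seq D -> a != 0.
Proof.
by move=> ra; apply/eqP => a0; have := pair_coroot ra; rewrite a0 pair0l.
Qed.
Lemma root_sign a : a \in root_seq D -> in_cone a \/ in_cone (- a).
Proof.
move=> ra; have [c [->|->]] := simple_base ra; [left|right]; apply/asboolP.
  by exists c.
by exists c; rewrite opprK.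
Qed.
Lemma root_signN a : a \in root_seq D -> ~~ in_cone a -> in_cone (- a).
Proof. by move=> ra; have [->|] := root_sign ra. Qed.
Lemma root_posN a : a \in root_seq D -> in_cone a -> ~~ in_cone (- a).
Proof.
move=> ra pa; apply/negP => na; have := root_neq0 ra.
by rewrite (cone_anti pa na) eqxx.
Qed.

Lemma refl_simple_pos i b : b \in root_seq D -> in_cone b ->
  ~~ in_cone (refl (alpha i) b) -> b = alpha i.
Proof.
move=> rb pb; have ri := simple_root_in i.
move/(root_signN (root_refl ri rb)); rewrite -/(refl _ _) => /asboolP[d dE].
have /asboolP[c cE] := pb.
set n := pairing b (coroot (alpha i)) in dE.
have : \sum_j alpha j *~ ((c j + d j)%N%:Z - (n *+ (j == i))) = 0.
  have S : \sum_j alpha j *~ (n *+ (j == i)) = alpha i *~ n.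
    rewrite (bigD1 i) //= eqxx mulr1n big1 ?addr0 // => j /negPf ->.
    by rewrite mulr0n mulr0z.
  rewrite (eq_bigr (fun j => (alpha j *+ c j + alpha j *+ d j)
                       - alpha j *~ (n *+ (j == i)))); last first.
    by move=> j _; rewrite mulrzBr -mulrnDr pmulrn.
  by rewrite sumrB big_split /= S -cE -dE /refl -/n opprB addrCA subrr addr0 subrr.
move=> /simple_free cd.
have bE : b = alpha i *~ c i.
  rewrite cE (bigD1 i) //= big1 ?addr0 // => j /negPf ji.
  by have := cd j; rewrite ji mulr0n subr0; case: (c j).
have [//|bN] : b = alpha i \/ b = - alpha i.
  by apply: (root_reduced rb ri (m := 1) (n := c i)) => //; rewrite mulr1z.
by have := root_posN ri (cone_simple i); rewrite -bN pb.
Qed.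

Definition sword (s : seq 'I_(ssrank D)) x := foldr (fun i => refl (alpha i)) x s.
Lemma sword_is_additive s : zmod_morphism (sword s).
Proof. by move=> x y; elim: s => //= i s ->; rewrite raddfB. Qed.
HB.instance Definition _ s :=
  GRing.isZmodMorphism.Build X X (sword s) (sword_is_additive s).
Lemma sword_root s a : a \in root_seq D -> sword s a \in root_seq D.
Proof. by move=> ra; elim: s => //= i s IH; apply: root_refl; rewrite ?simple_root_in. Qed.
Lemma sword_pair s a x : a \in root_seq D ->
  pairing (sword s x) (coroot (sword s a)) = pairing x (coroot a).
Proof.
by move=> ra; elim: s => //= i s IH; rewrite pair_refl ?simple_root_in ?sword_root.
Qed.
Lemma sword_refl s a x : a \in root_seq D ->
  refl (sword s a) (sword s x) = sword s (refl a x).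
Proof. by move=> ra; rewrite {1}/refl sword_pair // raddfB raddfMz. Qed.
Lemma refl_conj a b x : a \in root_seq D -> b \in root_seq D ->
  refl (refl a b) (refl a x) = refl a (refl b x).
Proof. by move=> ra rb; rewrite {1}/refl pair_refl // raddfB raddfMz. Qed.
Lemma sword_cat s t x : sword (s ++ t) x = sword s (sword t x).
Proof. by rewrite /sword foldr_cat. Qed.
Lemma sword_revK s : cancel (sword s) (sword (rev s)).
Proof.
move=> x; elim: s => //= i s IH; rewrite rev_cons /sword foldr_rcons -/(sword _ _).
by rewrite reflK ?simple_root_in.
Qed.

Lemma sword_exchange s i : ~~ in_cone (sword s (alpha i)) ->
  exists2 t, (size t < size s)%N & forall x, sword s (refl (alpha i) x) = sword t x.
Proof.
elim: s => [|j s IH] /=; first by rewrite cone_simple.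
have [pos neg|neg _] := boolP (in_cone (sword s (alpha i))); last first.
  have [t ts tE] := IH neg; exists (j :: t) => //= x.
  by rewrite tE.
exists s => // x.
have ri := simple_root_in i; have rj := simple_root_in j.
have E := refl_simple_pos (sword_root s ri) pos neg.
by rewrite -sword_refl // E reflK.
Qed.

Definition antidominant nu := forall i, pairing nu (coroot (alpha i)) <= 0.

Lemma antidominant_le s nu : antidominant nu -> in_cone (sword s nu - nu).
Proof.
move=> anu; have [n] := ubnP (size s); elim: n s => // n IH s.
case/lastP: s => [|s i]; first by rewrite /= subrr cone0.
rewrite size_rcons ltnS => sn.
have swE x : sword (rcons s i) x = sword s (refl (alpha i) x).
  by rewrite /sword foldr_rcons.
have [pos|neg] := boolP (in_cone (sword s (alpha i))); last first.
  have [t ts tE] := sword_exchange neg; rewrite swE tE; apply: IH; lia.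
rewrite swE raddfB raddfMz /=.
have := anu i; case: (pairing nu _) => [[|m]|m] //.
  by rewrite mulr0z subr0 => _; apply: IH.
move=> _; rewrite NegzE mulrNz opprK addrAC coneD //; first exact: IH.
by rewrite -pmulrn coneMn.
Qed.

Lemma antidominant_uniq s nu :
  antidominant nu -> antidominant (sword s nu) -> sword s nu = nu.
Proof.
move=> a1 a2; apply/eqP; rewrite -subr_eq0; apply/eqP; apply: cone_anti.
  exact: antidominant_le.
by rewrite opprB -{1}(sword_revK s nu) antidominant_le.
Qed.

Definition pos_roots := [seq a <- root_seq D | in_cone a].
Lemma pos_rootsE a : (a \in pos_roots) = in_cone a && (a \in root_seq D).
Proof. by rewrite mem_filter. Qed.
Lemma pos_root_seq_uniq : uniq pos_roots.
Proof. by rewrite filter_uniq // root_seq_uniq. Qed.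

Lemma antidominant_exists nu :
  exists2 s, antidominant (sword s nu) & in_cone (nu - sword s nu).
Proof.
pose N mu := count (fun b => 0 < pairing mu (coroot b)) pos_roots.
have [n] := ubnP (N nu); elim: n nu => // n IH nu Nn.
have [anu|] := pselect (antidominant nu).
  by exists [::] => //; rewrite /= subrr cone0.
move=> /existsNP[i /negP]; rewrite -ltNge => pi.
have ri := simple_root_in i.
have : (N (refl (alpha i) nu) < N nu)%N.
  rewrite /N -!size_filter.
  set s1 := filter _ _; set s2 := filter _ _.
  have is2 : alpha i \in s2 by rewrite mem_filter pi pos_rootsE cone_simple ri.
  have us1 : uniq s1 by rewrite filter_uniq // pos_root_seq_uniq.
  have um : uniq (alpha i :: [seq refl (alpha i) b | b <- s1]).
    rewrite /= map_inj_uniq ?us1 ?andbT; last exact: inv_inj (reflK ri).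
    apply/negP => /mapP[b]; rewrite mem_filter pos_rootsE => /and3P[_ pb rb] bE.
    have := congr1 (refl (alpha i)) bE; rewrite reflK // refl_id //.
    by move=> bE'; have := root_posN ri (cone_simple i); rewrite bE' pb.
  have := @uniq_leq_size _ _ s2 um; rewrite /= size_map; apply.
  move=> c; rewrite inE => /predU1P[->//|/mapP[b]].
  rewrite mem_filter pos_rootsE => /and3P[bp pb rb] ->.
  rewrite mem_filter pos_rootsE root_refl // andbT.
  have E := pair_refl (refl (alpha i) nu) ri rb; rewrite reflK // in E.
  rewrite E bp /=.
  apply: contraT => /(refl_simple_pos rb pb) bE.
  move: bp; rewrite -E bE refl_id // corootN // pairNr; lia.
move=> Nlt; have [|s as_ cs] := IH (refl (alpha i) nu); first lia.
exists (rcons s i); rewrite /sword foldr_rcons -/(sword s _) //.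
have -> : nu - sword s (refl (alpha i) nu) =
  alpha i *~ pairing nu (coroot (alpha i)) + (refl (alpha i) nu - sword s (refl (alpha i) nu)).
  by rewrite /refl addrA [in RHS]addrCA subrr addr0.
apply: coneD => //; move: pi; case: (pairing nu _) => // m _.
by rewrite -pmulrn coneMn ?cone_simple.
Qed.

(* W as the group of automorphisms of wt generated by all root reflections.   *)
Definition in_weyl : pred (X -> X) := fun g =>
  `[< exists2 s : seq X, {subset s <= root_seq D} & g = (fun x => foldr refl x s) >].

Record weyl := Weyl { weyl_fun :> X -> X; _ : in_weyl weyl_fun }.
HB.instance Definition _ := [isSub for weyl_fun].
HB.instance Definition _ := [Choice of weyl by <:].

Lemma weylP (g h : weyl) : g =1 h -> g = h.
Proof. by move=> gh; apply: val_inj; apply: funext. Qed.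

Lemma weyl_word (g : weyl) : exists s : seq X,
  {subset s <= root_seq D} /\ forall x, g x = foldr refl x s.
Proof. by case: g => g /= /asboolP[s sr ->]; exists s. Qed.

Lemma weyl1_subproof : in_weyl id.
Proof. by apply/asboolP; exists [::]. Qed.
Definition weyl1 := Weyl weyl1_subproof.

Lemma weylM_subproof (g h : weyl) : in_weyl (g \o h).
Proof.
have [s [sr sE]] := weyl_word g; have [t [tr tE]] := weyl_word h.
apply/asboolP; exists (s ++ t).
  by move=> x; rewrite mem_cat => /orP[/sr|/tr].
by apply: funext => x /=; rewrite foldr_cat sE tE.
Qed.
Definition weylM g h := Weyl (weylM_subproof g h).

Lemma foldr_reflK s : {subset s <= root_seq D} ->
  cancel (fun x => foldr refl x s) (fun x => foldr refl x (rev s)).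
Proof.
elim: s => //= a s IH sr x; rewrite rev_cons foldr_rcons reflK; last first.
  by apply: sr; rewrite mem_head.
by rewrite IH // => b bs; apply: sr; rewrite inE bs orbT.
Qed.

Lemma weylV_subproof (g : weyl) : exists h : weyl, cancel g h /\ cancel h g.
Proof.
have [s [sr sE]] := weyl_word g.
have sr' : {subset rev s <= root_seq D} by move=> x; rewrite mem_rev => /sr.
have wr : in_weyl (fun x => foldr refl x (rev s)) by apply/asboolP; exists (rev s).
exists (Weyl wr); split=> x /=; rewrite sE; first exact: foldr_reflK.
by have := foldr_reflK sr' x; rewrite revK.
Qed.
Definition weylV (g : weyl) : weyl := projT1 (cid (weylV_subproof g)).
Lemma weylVK (g : weyl) : cancel g (weylV g).
Proof. by rewrite /weylV; case: cid => h []. Qed.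
Lemma weylKV (g : weyl) : cancel (weylV g) g.
Proof. by rewrite /weylV; case: cid => h []. Qed.

Lemma weyl_mulA : associative weylM. Proof. by move=> g h k; apply: weylP. Qed.
Lemma weyl_mul1 : left_id weyl1 weylM. Proof. by move=> g; apply: weylP. Qed.
Lemma weyl_mulr1 : right_id weyl1 weylM. Proof. by move=> g; apply: weylP. Qed.
Lemma weyl_mulV : left_inverse weyl1 weylV weylM.
Proof. by move=> g; apply: weylP => x; rewrite /= weylVK. Qed.
Lemma weyl_mulrV : right_inverse weyl1 weylV weylM.
Proof. by move=> g; apply: weylP => x; rewrite /= weylKV. Qed.
HB.instance Definition _ := isGroup.Build weyl
  weyl_mulA weyl_mul1 weyl_mulr1 weyl_mulV weyl_mulrV.

Lemma weyl_is_additive (g : weyl) : zmod_morphism g.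
Proof.
move=> x y; have [s [_ sE]] := weyl_word g; rewrite !sE.
by elim: s {sE} => //= a s ->; rewrite raddfB.
Qed.
HB.instance Definition _ (g : weyl) :=
  GRing.isZmodMorphism.Build X X g (weyl_is_additive g).

Definition bform x y := \sum_(b <- root_seq D) pairing x (coroot b) * pairing y (coroot b).

Lemma bform_refl a x y : a \in root_seq D -> bform (refl a x) (refl a y) = bform x y.
Proof.
move=> ra; rewrite /bform.
have P : perm_eq (root_seq D) [seq refl a b | b <- root_seq D].
  apply: uniq_perm; rewrite ?root_seq_uniq ?map_inj_uniq ?root_seq_uniq //.
    exact: inv_inj (reflK ra).
  move=> b; apply/idP/mapP => [rb|[c rc ->]]; last exact: root_refl.
  by exists (refl a b); rewrite ?reflK ?root_refl.
rewrite (perm_big _ P) big_map /= big_seq [RHS]big_seq.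
by apply: eq_bigr => b rb; rewrite !pair_refl.
Qed.

Lemma bform_root a x : a \in root_seq D -> bform x a *+ 2 = pairing x (coroot a) * bform a a.
Proof.
move=> ra; have := bform_refl x a ra; rewrite refl_id //.
have -> : bform (refl a x) (- a) = - bform x a + pairing x (coroot a) * bform a a.
  rewrite /bform mulr_sumr -sumrN -big_split; apply: eq_bigr => b _ /=.
  by rewrite /refl pairBl pairMzl pairNl; ring.
move=> E; lia.
Qed.

Lemma bform_gt0 a : a \in root_seq D -> 0 < bform a a.
Proof.
move=> ra; rewrite /bform (bigD1_seq a) ?root_seq_uniq //= pair_coroot //.
apply: ltr_wpDr => //; apply: sumr_ge0 => b _; exact: sqr_ge0.
Qed.

Lemma root_descent b : b \in root_seq D -> in_cone b ->
  exists i, 0 < pairing b (coroot (alpha i)).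
Proof.
move=> rb /asboolP[c bE]; apply: contrapT => no.
suff : bform b b <= 0 by rewrite leNgt bform_gt0.
have -> : bform b b = \sum_i bform b (alpha i) *+ c i.
  rewrite /bform (eq_bigr (fun i => \sum_(d <- root_seq D)
    (pairing b (coroot d) * pairing (alpha i) (coroot d)) *+ c i)); last first.
    by move=> i _; rewrite -sumrMnl.
  rewrite exchange_big; apply: eq_bigr => d _ /=.
  have P : pairing b (coroot d) = \sum_i pairing (alpha i) (coroot d) *+ c i.
    rewrite {1}bE (zmod_morphism_sum _ _ (@pairBl D (coroot d))).
    by apply: eq_bigr => i _; rewrite pmulrn pairMzl -mulr_natr natz.
  rewrite {2}P.
  by rewrite mulr_sumr; apply: eq_bigr => i _; rewrite mulrnAr.
apply: sumr_le0 => i _; apply: mulrn_wle0.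
have : ~ 0 < pairing b (coroot (alpha i)) by move=> h; apply: no; exists i.
have := bform_root b (simple_root_in i); have := bform_gt0 (simple_root_in i).
move=> h1 h2 /negP; rewrite -leNgt => h3.
suff : bform b (alpha i) *+ 2 <= 0 by lia.
by rewrite h2 mulr_le0_ge0 // ltW.
Qed.

Lemma reflN b : b \in root_seq D -> refl (- b) =1 refl b.
Proof. by move=> rb x; rewrite /refl corootN // pairNr mulrNz mulNrz opprK. Qed.

Lemma cone_sword b : b \in root_seq D -> in_cone b -> exists s, refl b =1 sword s.
Proof.
move=> rb pb; have /asboolP[c bE] := pb.
have [n] := ubnP (\sum_i c i)%N; elim: n b c bE rb pb => // n IH b c bE rb pb cn.
have [[i ->]|ns] := pselect (exists i, b = alpha i); first by exists [:: i].
have [i bi] := root_descent rb pb; have ri := simple_root_in i.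
have pr : in_cone (refl (alpha i) b).
  by apply: contraT => /(refl_simple_pos rb pb) bi'; case: ns; exists i.
have /asboolP[d dE] := pr.
set m := pairing b (coroot (alpha i)) in bi.
have : \sum_j alpha j *~ ((c j)%:Z - m *+ (j == i) - (d j)%:Z) = 0.
  have S : \sum_j alpha j *~ (m *+ (j == i)) = alpha i *~ m.
    rewrite (bigD1 i) //= eqxx mulr1n big1 ?addr0 // => j /negPf ->.
    by rewrite mulr0n mulr0z.
  rewrite (eq_bigr (fun j => alpha j *+ c j - alpha j *~ (m *+ (j == i))
                       - alpha j *+ d j)); last first.
    by move=> j _; rewrite !mulrzBr -!pmulrn.
  by rewrite !sumrB S -bE -dE /refl -/m subrr.
move=> /simple_free cd.
have dn : (\sum_j d j < n)%N.
  rewrite ltnS in cn; apply: leq_trans cn.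
  rewrite (bigD1 i) //= [X in (_ < X)%N](bigD1 i) //=.
  have -> : (\sum_(j | j != i) d j = \sum_(j | j != i) c j)%N.
    by apply: eq_bigr => j /negPf ji; have := cd j; rewrite ji mulr0n; lia.
  by have := cd i; rewrite eqxx mulr1n ltn_add2r; move: bi; clear; lia.
have [s sE] := IH _ d dE (root_refl ri rb) pr dn.
exists (i :: rcons s i) => x; rewrite /= /sword foldr_rcons -/(sword s _) -sE.
by rewrite refl_conj // reflK.
Qed.

Lemma weyl_sword (g : weyl) : exists s, g =1 sword s.
Proof.
have [s [sr sE]] := weyl_word g.
suff [t tE] : exists t, (fun x => foldr refl x s) =1 sword t.
  by exists t => x; rewrite sE tE.
elim: s {sE} sr => [|b s IH] sr; first by exists [::].
have [|t tE] := IH; first by move=> a sa; apply: sr; rewrite inE sa orbT.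
have rb : b \in root_seq D by apply: sr; rewrite mem_head.
have [u uE] : exists u, refl b =1 sword u.
  have [pb|nb] := root_sign rb; first exact: cone_sword.
  have [u uE] := cone_sword (rootN rb) nb; exists u => x.
  by rewrite -uE reflN.
by exists (u ++ t) => x; rewrite sword_cat -uE -tE.
Qed.

Lemma sword_weyl s : in_weyl (sword s).
Proof.
apply/asboolP; exists [seq alpha i | i <- s].
  by move=> x /mapP[i _ ->]; exact: simple_root_in.
by apply: funext => x; elim: s => //= i s ->.
Qed.

Definition conj_antidominant nu mu :=
  antidominant mu /\ exists w : weyl, mu = w nu.

(* nu_- ; existence and uniqueness are antiP and anti_uniq. *)
Definition anti nu := xget nu [set mu | conj_antidominant nu mu].

Lemma antiP nu : conj_antidominant nu (anti nu).
Proof.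
rewrite /anti; case: xgetP => [mu _ //|].
have [s as_ _] := antidominant_exists nu.
by move/(_ (sword s nu)); case; split=> //; exists (Weyl (sword_weyl s)).
Qed.

Lemma anti_uniq nu mu : conj_antidominant nu mu -> mu = anti nu.
Proof.
move=> [amu [w wE]]; have [anu [v vE]] := antiP nu.
have [s sE] := weyl_sword (v * w^-1)%g.
have E : anti nu = sword s mu by rewrite -sE wE vE /= weylVK.
by rewrite E antidominant_uniq // -E.
Qed.

Lemma anti_weyl (w : weyl) nu : anti (w nu) = anti nu.
Proof.
have [anu [v vE]] := antiP (w nu).
by apply: anti_uniq; split=> //; exists (v * w)%g; rewrite vE.
Qed.

Lemma anti_le nu : in_cone (nu - anti nu).
Proof.
have [s as_ cs] := antidominant_exists nu.
by rewrite -(@anti_uniq nu (sword s nu)) //; split=> //; exists (Weyl (sword_weyl s)).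
Qed.

Lemma anti_weyl_le (w : weyl) nu : in_cone (w nu - anti nu).
Proof. by rewrite -(anti_weyl w) anti_le. Qed.

Lemma anti0 : anti 0 = 0.
Proof.
by apply/esym/anti_uniq; split; [move=> i; rewrite pair0l | exists 1%g].
Qed.

Lemma antiD_ge nu mu : in_cone (anti (nu + mu) - (anti nu + anti mu)).
Proof.
have [_ [w ->]] := antiP (nu + mu).
by rewrite raddfD opprD addrACA coneD // anti_weyl_le.
Qed.

(* X^*(T_ad)_pos, generated by the positive roots. *)
Definition pos_lattice : pred X := fun mu =>
  `[< exists c : X -> nat, mu = \sum_(b <- pos_roots) b *+ c b >].

Lemma pos_latticeE mu : (mu \in pos_lattice) = in_cone mu.
Proof.
apply/asboolP/idP => [[c ->]|/asboolP[c ->]].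
  rewrite big_seq; elim/big_ind: _ => [||b]; [exact: cone0|exact: coneD|].
  by rewrite pos_rootsE => /andP[pb _]; exact: coneMn.
exists (fun b => \sum_(i | alpha i == b) c i)%N.
rewrite (eq_bigr (fun b => \sum_(i | alpha i == b) alpha i *+ c i)); last first.
  by move=> b _; rewrite -sumrMnr; apply: eq_bigr => i /eqP ->.
rewrite (exchange_big_dep xpredT) //=; apply: eq_bigr => i _.
rewrite (big_rem (alpha i)) ?pos_rootsE ?cone_simple ?simple_root_in //= eqxx.
rewrite big1_seq ?addr0 // => b /andP[/eqP <-].
by rewrite mem_rem_uniq ?pos_root_seq_uniq // inE eqxx.
Qed.

Lemma pos_lattice_closed : addr_closed pos_lattice.
Proof.
split; first by rewrite pos_latticeE cone0.
by move=> x y; rewrite !pos_latticeE; exact: coneD.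
Qed.
HB.instance Definition _ := GRing.isAddClosed.Build X pos_lattice pos_lattice_closed.

Record pos_root_monoid := PosRoot
  { pos_root_val :> X; _ : pos_lattice pos_root_val }.
HB.instance Definition _ := [isSub for pos_root_val].
HB.instance Definition _ := [Choice of pos_root_monoid by <:].
HB.instance Definition _ := GRing.SubChoice_isSubNmodule.Build X pos_lattice pos_root_monoid
  pos_lattice_closed.

(* The exponents (nu_1, nu_2) of the monomials of Z[V]. *)
Definition vinberg_cone : pred (X * X) := fun p => p.2 + anti p.1 \in pos_lattice.

Lemma vinberg_coneE p : (p \in vinberg_cone) = in_cone (p.2 + anti p.1).
Proof. by rewrite -[LHS]/(_ \in pos_lattice) pos_latticeE. Qed.

Lemma vinberg_cone_closed : addr_closed vinberg_cone.
Proof.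
split; first by rewrite vinberg_coneE /= anti0 addr0 cone0.
move=> p q; rewrite !vinberg_coneE /= => pp qq.
have -> : p.2 + q.2 + anti (p.1 + q.1) = p.2 + anti p.1 + (q.2 + anti q.1) +
    (anti (p.1 + q.1) - (anti p.1 + anti q.1)).
  rewrite [X in _ = X + _]addrACA -[RHS]addrA; congr (_ + _).
  by rewrite [RHS]addrC subrK.
by apply: coneD; [exact: coneD | exact: antiD_ge].
Qed.
HB.instance Definition _ :=
  GRing.isAddClosed.Build (X * X)%type vinberg_cone vinberg_cone_closed.

Record vinberg_monoid := Vinberg
  { vinberg_val :> X * X; _ : vinberg_cone vinberg_val }.
HB.instance Definition _ := [isSub for vinberg_val].
HB.instance Definition _ := [Choice of vinberg_monoid by <:].
HB.instance Definition _ := GRing.SubChoice_isSubNmodule.Build (X * X)%type vinberg_cone vinberg_monoid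
  vinberg_cone_closed.

End RootDatum.

Section DualSide.
Variable D : based_root_datum.
Local Notation X := (wt D).
Implicit Types (mu nu : X) (w : weyl D).

(* The fundamental coweights of the adjoint group form the basis of           *)
(* X_*(T_ad) = Hom(X^*(T_ad), Z) dual to the simple roots: the i-th one reads *)
(* the i-th coordinate on the root lattice.  The values outside the root      *)
(* lattice are irrelevant.                                                    *)
Definition simple_coord mu : 'I_(ssrank D) -> int :=
  xget (fun=> 0) [set c | mu = \sum_i simple_root i *~ c i].

Definition fundamental_coweight i mu : int := simple_coord mu i.

Definition rho_ad mu : int := \sum_i fundamental_coweight i mu.

Lemma simple_coordE mu (c : 'I_(ssrank D) -> int) :
  mu = \sum_i simple_root i *~ c i -> simple_coord mu = c.
Proof.
move=> cE; rewrite /simple_coord; case: xgetP => [d _ dE|/(_ c)//].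
have : \sum_i simple_root i *~ (d i - c i) = 0.
  by under eq_bigr do rewrite mulrzBr; rewrite sumrB -dE -cE subrr.
by move=> /simple_free dc; apply: funext => i; apply/eqP; rewrite -subr_eq0 dc.
Qed.

Lemma rho_ad_cone (c : 'I_(ssrank D) -> nat) :
  rho_ad (\sum_i simple_root i *+ c i) = (\sum_i c i)%N.
Proof.
rewrite /rho_ad -natz natr_sum; apply: eq_bigr => i _; rewrite natz.
by rewrite /fundamental_coweight (simple_coordE (c := fun i => c i)).
Qed.

Definition q_rho (mu : pos_root_monoid D) : {poly int} := 'X^`|rho_ad mu|.

Lemma q_rho0 : q_rho 0 = 1.
Proof.
rewrite /q_rho (_ : val (0 : pos_root_monoid D) = \sum_(i < ssrank D) simple_root i *+ 0).
  by rewrite rho_ad_cone big1.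
by rewrite big1.
Qed.

Lemma q_rhoD (mu nu : pos_root_monoid D) : q_rho (mu + nu) = q_rho mu * q_rho nu.
Proof.
case: mu nu => [mu pm] [nu pn].
have /asboolP[c cE] : in_cone mu by rewrite -pos_latticeE.
have /asboolP[d dE] : in_cone nu by rewrite -pos_latticeE.
have S : pos_root_val (PosRoot pm + PosRoot pn) = \sum_i simple_root i *+ (c i + d i).
  rewrite -[LHS]/(mu + nu) cE dE -big_split; apply: eq_bigr => i _ /=.
  by rewrite mulrnDr.
by rewrite /q_rho S -exprD /= cE dE !rho_ad_cone big_split.
Qed.

(* Z[X^*(T_ad)_pos] and Z[V]; the element e_1^nu1 (x) e_2^nu2 of Z[V] is       *)
(* mexp of the pair (nu1, nu2), and vinberg_incl is the embedding of Z[V] in  *)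
(* Z[T] (x) Z[T] = Z[X^*(T) x X^*(T)].                                          *)
Definition ad_ring := monoid_ring (pos_root_monoid D).
Definition vinberg_ring := monoid_ring (vinberg_monoid D).
HB.instance Definition _ := GRing.ComNzRing.on ad_ring.
HB.instance Definition _ := GRing.ComNzRing.on vinberg_ring.

Definition vinberg_incl : vinberg_ring -> monoid_ring (X * X)%type :=
  mext (fun p : vinberg_monoid D => mexp (val p)).
HB.instance Definition _ := GRing.Additive.on vinberg_incl.

Lemma vinberg_incl_mul : monoid_morphism vinberg_incl.
Proof. by apply: mext_is_multiplicative => [|p q]; rewrite -?mexpD. Qed.
HB.instance Definition _ := GRing.isMonoidMorphism.Build vinberg_ring
  (monoid_ring (X * X)%type) vinberg_incl vinberg_incl_mul.

Lemma vinberg_incl_inj : injective vinberg_incl.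
Proof.
apply: raddf_inj => g g0; apply/malgP => k; rewrite mcoeff0.
suff <- : mcoeff (val k) (vinberg_incl g : {malg int[(X * X)%type]}) = mcoeff k (g : {malg int[vinberg_monoid D]}).
  by rewrite g0 mcoeff0.
move: (g); apply: mext_unique => [a b|a b|m].
- by rewrite raddfB mcoeffB.
- exact: mcoeffB.
by rewrite /vinberg_incl mext_mexp /mexp !mcoeffU (inj_eq val_inj).
Qed.

Definition rho_eval : ad_ring -> {poly int} := mext q_rho.
HB.instance Definition _ := GRing.Additive.on rho_eval.
Lemma rho_eval_mul : monoid_morphism rho_eval.
Proof. exact: mext_is_multiplicative q_rho0 q_rhoD. Qed.
HB.instance Definition _ := GRing.isMonoidMorphism.Build ad_ring {poly int} rho_eval
  rho_eval_mul.

Lemma e2_subproof (mu : pos_root_monoid D) : vinberg_cone (0, val mu).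
Proof. by rewrite /vinberg_cone /= anti0 addr0; case: mu. Qed.
Definition e2 (mu : pos_root_monoid D) : vinberg_monoid D := Vinberg (e2_subproof mu).

Definition ad_to_vinberg : ad_ring -> vinberg_ring := mext (fun mu : pos_root_monoid D => mexp (e2 mu)).
HB.instance Definition _ := GRing.Additive.on ad_to_vinberg.
Lemma ad_to_vinberg_mul : monoid_morphism ad_to_vinberg.
Proof.
apply: mext_is_multiplicative => [|mu nu]; rewrite -?mexp0 -?mexpD; congr mexp; apply: val_inj => //=.
by rewrite -[RHS]/(val (e2 mu) + val (e2 nu)) -[RHS]/(0 + 0, val mu + val nu) addr0.
Qed.
HB.instance Definition _ := GRing.isMonoidMorphism.Build ad_ring vinberg_ring
  ad_to_vinberg ad_to_vinberg_mul.

Definition rho_ideal : pred {poly vinberg_ring} := bc_ideal ad_to_vinberg rho_eval.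

Definition vaug : vinberg_ring -> int := mext (fun=> 1).
HB.instance Definition _ := GRing.Additive.on vaug.
Lemma vaug_mul : monoid_morphism vaug.
Proof. by apply: mext_is_multiplicative => // *; rewrite mulr1. Qed.
HB.instance Definition _ := GRing.isMonoidMorphism.Build vinberg_ring int vaug vaug_mul.


Definition aug1 (p : {poly vinberg_ring}) : int := (map_poly vaug p).[1].
Lemma aug1_zmod : zmod_morphism aug1.
Proof. by move=> p q; rewrite /aug1 raddfB /= hornerD hornerN. Qed.
Lemma aug1_mul : monoid_morphism aug1.
Proof.
split; first by rewrite /aug1 rmorph1 hornerC.
by move=> p q; rewrite /aug1 rmorphM /= hornerM.
Qed.
HB.instance Definition _ :=
  GRing.isZmodMorphism.Build {poly vinberg_ring} int aug1 aug1_zmod.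
HB.instance Definition _ :=
  GRing.isMonoidMorphism.Build {poly vinberg_ring} int aug1 aug1_mul.

Lemma aug1_relator a : aug1 (ad_to_vinberg a)%:P = aug1 (map_poly intr (rho_eval a)).
Proof.
move: a; apply: mext_unique.
- by move=> a b; rewrite raddfB polyCB raddfB.
- by move=> a b; rewrite !raddfB.
move=> mu; rewrite /aug1 /ad_to_vinberg /rho_eval !mext_mexp map_polyC hornerC /=.
rewrite /q_rho (rmorphXn (map_poly intr)) /= map_polyX (rmorphXn (map_poly vaug)) /=.
by rewrite map_polyX hornerXn expr1n /vaug mext_mexp.
Qed.

Lemma rho_idealr : idealr_closed rho_ideal.
Proof.
have [z B] := bc_ideal_zmod ad_to_vinberg rho_eval; split=> //.
  apply/negP => /(bc_ideal_rmorph aug1_relator).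
  by rewrite rmorph1 => /eqP; rewrite oner_eq0.
move=> a u v uI vI; rewrite -[v]opprK B //; first exact: bc_idealM.
by rewrite -[- v]add0r B.
Qed.
Definition rho_idealr_inst := isIdealr.Build _ rho_ideal rho_idealr.

Definition rho_idealI : idealr {poly vinberg_ring} := HB.pack rho_ideal rho_idealr_inst.

(* The ring of functions of V_rho, a Z[q]-algebra. *)
Definition V_rho := {ideal_quot rho_idealI}.
HB.instance Definition _ := GRing.ComNzRing.on V_rho.

Definition rho_pi : {poly vinberg_ring} -> V_rho := \pi_V_rho.
Lemma rho_pi_zmod : zmod_morphism rho_pi.
Proof. exact: pi_is_zmod_morphism. Qed.
Lemma rho_pi_mul : monoid_morphism rho_pi.
Proof. exact: pi_is_monoid_morphism. Qed.
HB.instance Definition _ :=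
  GRing.isZmodMorphism.Build {poly vinberg_ring} V_rho rho_pi rho_pi_zmod.
HB.instance Definition _ :=
  GRing.isMonoidMorphism.Build {poly vinberg_ring} V_rho rho_pi rho_pi_mul.

Lemma rho_pi_eq p q : (rho_pi p == rho_pi q) = (p - q \in rho_ideal).
Proof. by rewrite [RHS](Quotient.idealrBE rho_idealI). Qed.

Lemma rho_pi_surj x : rho_pi (repr x) = x.
Proof. exact: reprK. Qed.

Definition V_rho_scale (p : {poly int}) (x : V_rho) : V_rho :=
  rho_pi (map_poly intr p) * x.
Lemma V_rho_scaleA p q x : V_rho_scale p (V_rho_scale q x) = V_rho_scale (p * q) x.
Proof. by rewrite /V_rho_scale !rmorphM mulrA. Qed.
Lemma V_rho_scale1 : left_id 1 V_rho_scale.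
Proof. by move=> x; rewrite /V_rho_scale !rmorph1 mul1r. Qed.
Lemma V_rho_scaleDr : right_distributive V_rho_scale +%R.
Proof. by move=> p x y; rewrite /V_rho_scale mulrDr. Qed.
Lemma V_rho_scaleDl x : {morph V_rho_scale^~ x : p q / p + q}.
Proof. by move=> p q; rewrite /V_rho_scale !rmorphD mulrDl. Qed.
HB.instance Definition _ := GRing.Zmodule_isLmodule.Build {poly int} V_rho
  V_rho_scaleA V_rho_scale1 V_rho_scaleDr V_rho_scaleDl.
Lemma V_rho_scaleAl (p : {poly int}) (x y : V_rho) : p *: (x * y) = (p *: x) * y.
Proof. exact: mulrA. Qed.
HB.instance Definition _ := GRing.Lmodule_isLalgebra.Build {poly int} V_rho
  V_rho_scaleAl.
HB.instance Definition _ := GRing.Lalgebra_isComAlgebra.Build {poly int} V_rho.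

(* f |-> f|_rho *)
Definition rho_restrict (f : vinberg_ring) : V_rho := rho_pi f%:P.

Lemma weyl_vinberg_subproof w (p : vinberg_monoid D) :
  vinberg_cone (w (val p).1, (val p).2).
Proof. by rewrite /vinberg_cone /= anti_weyl; case: p. Qed.
Definition weyl_vinberg w (p : vinberg_monoid D) := Vinberg (weyl_vinberg_subproof w p).

Definition vinberg_act w : vinberg_ring -> vinberg_ring :=
  mext (fun p : vinberg_monoid D => mexp (weyl_vinberg w p)).
HB.instance Definition _ w := GRing.Additive.on (vinberg_act w).
Lemma vinberg_act_mul w : monoid_morphism (vinberg_act w).
Proof.
apply: mext_is_multiplicative => [|[p Pp] [q Pq]]; rewrite -?mexp0 -?mexpD; congr mexp; apply: val_inj => /=.
  by rewrite raddf0.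
rewrite -[in LHS]/(p + q) -[RHS]/((w p.1, p.2) + (w q.1, q.2)).
by rewrite raddfD.
Qed.
HB.instance Definition _ w := GRing.isMonoidMorphism.Build vinberg_ring vinberg_ring
  (vinberg_act w) (vinberg_act_mul w).

Lemma vinberg_act_ad w a : vinberg_act w (ad_to_vinberg a) = ad_to_vinberg a.
Proof.
move: a; apply: mext_unique => [a b|a b|mu]; rewrite ?raddfB //.
rewrite /ad_to_vinberg mext_mexp /vinberg_act mext_mexp; congr mexp.
by apply: val_inj; rewrite /= raddf0.
Qed.

(* W acts coefficientwise on Z[V][q]; V_rho_actE is the independence of the   *)
(* representative.                                                            *)
Definition V_rho_act w (x : V_rho) : V_rho :=
  rho_pi (map_poly (vinberg_act w) (repr x)).

Lemma V_rho_actE w p : V_rho_act w (rho_pi p) = rho_pi (map_poly (vinberg_act w) p).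
Proof.
apply/eqP; rewrite rho_pi_eq -raddfB /=.
have : repr (rho_pi p) - p \in rho_ideal by rewrite -rho_pi_eq rho_pi_surj.
move=> /asboolP[s ->]; apply/asboolP.
exists [seq (map_poly (vinberg_act w) r.1, r.2) | r <- s].
rewrite big_map raddf_sum; apply: eq_bigr => r _ /=; rewrite rmorphM /=; congr (_ * _).
rewrite /bc_relator raddfB /= map_polyC /= vinberg_act_ad; congr (_ - _).
by rewrite -map_poly_comp; apply: eq_map_poly => n /=; rewrite rmorph_int.
Qed.

Lemma e1e2_subproof nu : vinberg_cone (nu, - anti nu).
Proof. by rewrite /vinberg_cone /= addNr; have := cone0 D; rewrite -pos_latticeE. Qed.
(* e_1^nu (x) e_2^(- nu_-) *)
Definition bernstein_exponent nu : vinberg_monoid D := Vinberg (e1e2_subproof nu).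
End DualSide.

Section HeckeSide.
Variable D : based_root_datum.
Local Notation X := (wt D).
Implicit Types (nu : X) (w : weyl D).

(* N(F)/T(o_F) = X_*(T) x| W, split by N(o_F)/T(o_F) = W; the pair (nu, w)    *)
(* is e^nu w, acting on the apartment wt (x) R by v |-> nu + w v.               *)
Definition ext_weyl : Type := X * weyl D.
HB.instance Definition _ := Choice.copy ext_weyl (X * weyl D)%type.
Implicit Types (x y : ext_weyl).

Definition ext_weyl1 : ext_weyl := (0, 1%g).
Definition ext_weylM x y : ext_weyl := (x.1 + x.2 y.1, x.2 * y.2)%g.
Definition ext_weylV x : ext_weyl := (- (x.2^-1)%g x.1, x.2^-1)%g.
Lemma ext_weylA : associative ext_weylM.
Proof. by move=> x y z; rewrite /ext_weylM /= raddfD addrA mulgA. Qed.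
Lemma ext_weyl_mul1 : left_id ext_weyl1 ext_weylM.
Proof. by move=> [nu w]; rewrite /ext_weylM /= add0r mul1g. Qed.
Lemma ext_weyl_mulr1 : right_id ext_weyl1 ext_weylM.
Proof. by move=> [nu w]; rewrite /ext_weylM /= raddf0 addr0 mulg1. Qed.
Lemma ext_weyl_mulV : left_inverse ext_weyl1 ext_weylV ext_weylM.
Proof. by move=> [nu w]; rewrite /ext_weylM /= addNr mulVg. Qed.
Lemma ext_weyl_mulrV : right_inverse ext_weyl1 ext_weylV ext_weylM.
Proof. move=> [nu w]; rewrite /ext_weylM /= raddfN mulgV; congr (_, _).
apply/eqP; rewrite subr_eq0; apply/eqP/esym; exact: weylKV. Qed.
HB.instance Definition _ := isGroup.Build ext_weyl
  ext_weylA ext_weyl_mul1 ext_weyl_mulr1 ext_weyl_mulV ext_weyl_mulrV.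

Definition transl nu : ext_weyl := (nu, 1%g).

(* The number of hyperplanes <alpha, .> = k, alpha a positive root of G and k *)
(* an integer, between C and x C, where C is the alcove of the dominant       *)
(* chamber containing 0 in its closure: for x = e^nu w, <alpha, .> takes its  *)
(* values in ]n, n+1[ on x C if w^-1 alpha > 0 and in ]n-1, n[ otherwise,     *)
(* with n = <alpha, nu>.  The root alpha of G is written coroot b.            *)
Definition ext_length x : nat :=
  (\sum_(b <- pos_roots D)
    `|pairing x.1 (coroot b) - (~~ in_cone ((x.2^-1)%g b))%:Z|)%N.

Lemma wrefl_subproof a : in_weyl (if a \in root_seq D then refl a else id).
Proof.
case: ifP => ra; last exact: weyl1_subproof.
by apply/asboolP; exists [:: a] => // b; rewrite inE => /eqP ->.
Qed.
(* Junk value 1 when a is not a root. *)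
Definition wrefl a : weyl D := Weyl (wrefl_subproof a).

(* coroot b is maximal among the roots of G for the dominance order, i.e. it  *)
(* is the highest root of one irreducible component.                          *)
Definition highest_coroot (b : X) : Prop :=
  b \in root_seq D /\ forall a (c : 'I_(ssrank D) -> nat), a \in root_seq D ->
    coroot a = coroot b + \sum_i coroot (simple_root i) *+ c i -> a = b.

(* The simple affine roots of G are the simple roots alpha_i and the affine   *)
(* functions 1 - theta, theta a highest root; b stands for the gradient       *)
(* coroot b, namely alpha_i or - theta.                                       *)
Definition simple_affine (b : X) : Prop :=
  (exists i, b = simple_root i) \/ highest_coroot (- b).

(* The reflection fixing the zero set of the simple affine root of gradient   *)
(* coroot b: s_i, resp. v |-> s_theta(v) + theta^vee.  S_aff is the set of    *)
(* affine_refl b for simple_affine b.                                         *)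
Definition affine_refl (b : X) : ext_weyl := (if in_cone b then 0 else - b, wrefl b).

Definition reduced_decomposition x (s : seq X) (u : ext_weyl) : Prop :=
  [/\ forall b, b \in s -> simple_affine b,
      x = ((\prod_(b <- s) affine_refl b) * u)%g,
      size s = ext_length x & ext_length u = 0%N].

(* 'X is q; the axioms determine the algebra up to a unique isomorphism       *)
(* preserving T.                                                              *)
Record iwahori_hecke_algebra : Type := IwahoriHecke {
  hecke_alg :> algType {poly int};
  hecke_T : ext_weyl -> hecke_alg;
  hecke_T_basis : forall h, exists! c : {malg {poly int}[ext_weyl]},
    h = \sum_(x <- msupp c) c@_x *: hecke_T x;
  hecke_T_mul : forall x y, ext_length (x * y)%g = (ext_length x + ext_length y)%N ->
    hecke_T (x * y)%g = hecke_T x * hecke_T y;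
  hecke_T_sqr : forall b, simple_affine b ->
    hecke_T (affine_refl b) ^+ 2 = 'X%:A + ('X - 1) *: hecke_T (affine_refl b)
}.

Variable H : iwahori_hecke_algebra.
Local Notation T := (hecke_T H).

(* The crossing from x C to x s C, s = affine_refl b, is directed by          *)
(* - x.2 (coroot b); it goes towards the antidominant chamber iff x.2 b is    *)
(* positive.  The factor is then T_s, and T_s - (q - 1) = q T_s^-1 otherwise. *)
Fixpoint oriented_product x (s : seq X) (u : ext_weyl) : H :=
  if s is b :: s' then
    (if in_cone (x.2 b) then T (affine_refl b)
     else T (affine_refl b) - ('X - 1)%:A)
    * oriented_product (x * affine_refl b)%g s' u
  else T u.

(* Vigneras' E(x) for the antidominant orientation, read off some reduced     *)
(* decomposition of x (the result does not depend on it).                     *)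
Definition bernstein x : H :=
  let su := xget ([::], x) [set su | reduced_decomposition x su.1 su.2] in
  oriented_product 1%g su.1 su.2.

Definition bernstein_sum (E : X -> H) (c : {malg {poly int}[X]}) : H :=
  \sum_(nu <- msupp c) c@_nu *: E nu.

(* A(q), the Z[q]-span of the E(nu). *)
Definition bernstein_subalgebra : set H :=
  range (bernstein_sum (fun nu => bernstein (transl nu))).

(* w (\sum_nu c_nu E(nu)) = \sum_nu c_nu E(w nu); the family E(nu) is free,   *)
(* so that c is unique when a is in A(q), and the value is irrelevant         *)
(* otherwise.                                                                 *)
Definition bernstein_act w (a : H) : H :=
  bernstein_sum (fun nu => bernstein (transl (w nu)))
    (xget 0 [set c | a = bernstein_sum (fun nu => bernstein (transl nu)) c]).
End HeckeSide.
Arguments hecke_T {D} i x.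
Arguments bernstein {D} H x.
Arguments bernstein_subalgebra {D} H.
Arguments bernstein_act {D} H w a.
Arguments V_rho_act {D} w x.

Section AlgebraIso.
Variables (R : comNzRingType) (A A' : algType R).

Definition is_subalgebra (S : set A) : Prop :=
  [/\ S 1, forall (c : R) x y, S x -> S y -> S (c *: x + y) &
      forall x y, S x -> S y -> S (x * y)].
End AlgebraIso.

(* f restricts to an isomorphism of R-algebras from S to S'. *)
Definition is_algebra_iso (R : comNzRingType) (A A' : algType R)
    (S : set A) (S' : set A') (f : A -> A') : Prop :=
  [/\ is_subalgebra S /\ is_subalgebra S',
      forall (c : R) x y, S x -> S y -> f (c *: x + y) = c *: f x + f y,
      f 1 = 1,
      forall x y, S x -> S y -> f (x * y) = f x * f y &
      set_bij S S' f].

Definition fixed_points (W A : Type) (S : set A) (act : W -> A -> A) : set A :=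
  [set x | S x /\ forall w, act w x = x].

(* Main.v *)
From HB Require Import structures.
Require Import Defs.
From mathcomp Require Import all_boot all_order all_algebra finmap.
From mathcomp Require Import boolp classical_sets functions.
From mathcomp Require Import monalg.
From mathcomp Require Import zify ring.

Set Implicit Arguments.
Unset Strict Implicit.
Unset Printing Implicit Defensive.

Import Order.TTheory GRing.Theory Num.Theory.

Local Open Scope ring_scope.

(** Both algebras are the same subalgebra of a twisted group ring.  Put
    n(nu) = <nu - nu_-, rho_ad>, a natural number since nu - nu_- is a sum of
    positive roots.  In Z[q][X_*(T)], with basis e^nu, the elements
    q^n(nu) e^nu span a subalgebra over Z[q], with
    q^n(nu) e^nu . q^n(mu) e^mu = q^(n(nu) + n(mu) - n(nu + mu)) q^n(nu + mu) e^(nu + mu),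
    and the exponent <(nu + mu)_- - nu_- - mu_-, rho_ad> is again a natural
    number.  The Bernstein isomorphism identifies both E(nu) and the restriction
    of e_1^nu (x) e_2^(- nu_-) with q^n(nu) e^nu.

    On the Hecke side, the twisted group ring is seen through left multiplication
    by T_lambda for lambda far inside the antidominant chamber.  The defining
    product of E(nu) runs along a gallery of alcoves; translated by lambda, the
    gallery lies so deep that a crossing is directed towards the antidominant
    chamber exactly when it increases the length.  So T_lambda absorbs the factors
    of the product one by one, a crossing of the other direction releasing a
    factor q, and T_lambda E(nu) = q^n(nu) T_(lambda + nu)
    (oriented_product_deep, bernstein_deep).  As left multiplication by T_lambda
    is injective (hecke_T_lreg), the multiplication rule (bernsteinM) and the
    freeness of the E(nu) (bernstein_free) can be read off after it; no braid
    relation enters, and E(nu) is seen not to depend on the gallery.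

    On the dual side, e_1^nu1 (x) e_2^nu2 |-> q^<nu1 + nu2, rho_ad> e^nu1 is a
    ring homomorphism from the functions on V to Z[X_*(T)][q] that is compatible
    with the base change to the q-line (poly_twist_relator), hence the freeness of
    the restricted monomials (dual_monomial_free); they span because
    (nu1, nu2) is (nu1, - nu1_-) plus an exponent (0, mu) with mu in the positive
    root monoid, which the base change turns into a power of q.

    Both sides thus carry a Z[q]-basis indexed by X_*(T) with the same structure
    constants, and W permutes both bases through its action on the index, because
    (w nu)_- = nu_-.

    The extended affine Weyl group enters through the geometry of alcoves: how
    multiplication by a simple affine reflection changes the length, and the
    existence of reduced decompositions.  The length is half the sum of |d_x(b)|
    over all roots b for a cocycle d (displacement) which, for the reflection
    attached to a simple affine root a, is nonzero only at a and - a. *)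

(** * Root combinatorics *)

Section Roots.
Variable D : based_root_datum.
Local Notation X := (wt D).
Local Notation alpha := (@simple_root D).
Implicit Types (a b c x : X) (y z : cowt D) (i j : 'I_(ssrank D)).

Lemma pair_suml (I : Type) (r : seq I) (F : I -> X) y :
  pairing (\sum_(i <- r) F i) y = \sum_(i <- r) pairing (F i) y.
Proof. exact: (zmod_morphism_sum _ _ (@pairBl D y)). Qed.

Lemma pair_sumr (I : Type) (r : seq I) (F : I -> cowt D) x :
  pairing x (\sum_(i <- r) F i) = \sum_(i <- r) pairing x (F i).
Proof. exact: (zmod_morphism_sum _ _ (@pairBr D x)). Qed.

Lemma pairDr x y z : pairing x (y + z) = pairing x y + pairing x z.
Proof. by rewrite -[in RHS](addrK z y) (pairBr x (y + z) z) subrK. Qed.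

Lemma pair0r x : pairing x 0 = 0.
Proof. by rewrite -(subrr 0) (pairBr x) subrr. Qed.

Lemma pairMnl x (n : nat) y : pairing (x *+ n) y = pairing x y *+ n.
Proof. by rewrite pmulrn pairMzl -mulrzz -pmulrn. Qed.

Lemma pairMnr x (n : nat) y : pairing x (y *+ n) = pairing x y *+ n.
Proof. by rewrite pmulrn pairMzr -mulrzz -pmulrn. Qed.

(** A positive root made negative by s_i is alpha_i, so s_i permutes the others. *)
Lemma perm_simple_refl i :
  perm_eq (pos_roots D)
    (alpha i :: [seq refl (alpha i) b | b <- rem (alpha i) (pos_roots D)]).
Proof.
have ri := simple_root_in i; have pi := cone_simple i.
have u := pos_root_seq_uniq D.
have S b : b \in rem (alpha i) (pos_roots D) ->
    refl (alpha i) b \in rem (alpha i) (pos_roots D).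
  rewrite !mem_rem_uniq // !inE !pos_rootsE => /and3P[bi pb rb].
  rewrite (root_refl ri rb : refl (alpha i) b \in _) andbT; apply/andP; split.
    apply: contraTneq pb => E; have := reflK ri b.
    by rewrite E refl_id // => <-; exact: root_posN.
  by apply: contraT => /(refl_simple_pos rb pb) bE; rewrite bE eqxx in bi.
have P : perm_eq (rem (alpha i) (pos_roots D))
    [seq refl (alpha i) b | b <- rem (alpha i) (pos_roots D)].
  apply: uniq_perm; rewrite ?map_inj_uniq ?rem_uniq //.
    exact: inv_inj (reflK ri).
  move=> b; apply/idP/mapP => [bS|[d dS ->]]; last exact: S.
  by exists (refl (alpha i) b); rewrite ?reflK ?S.
apply: perm_trans (perm_to_rem (_ : alpha i \in _)) _; first by rewrite pos_rootsE pi ri.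
by rewrite perm_cons.
Qed.

(** For linear F this computes s_i of a sum over the positive roots; it yields the
    pairings of the two sums below with simple roots and coroots. *)
Lemma sum_simple_refl (V : zmodType) (F : X -> V) i :
  {in root_seq D, forall b, F (- b) = - F b} ->
  \sum_(b <- pos_roots D) F (refl (alpha i) b)
    = \sum_(b <- pos_roots D) F b - F (alpha i) *+ 2.
Proof.
move=> FN; have ri := simple_root_in i.
have iP : alpha i \in pos_roots D by rewrite pos_rootsE cone_simple ri.
rewrite (perm_big _ (perm_to_rem iP)) [in RHS](perm_big _ (perm_simple_refl i)) /= !big_cons big_map refl_id // FN //.
by rewrite mulr2n [RHS]addrAC opprD addrA subrr sub0r.
Qed.

Definition two_rho : X := \sum_(b <- pos_roots D) b.
Definition two_rho_vee : cowt D := \sum_(b <- pos_roots D) coroot b.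

Lemma two_rho_simple i : pairing two_rho (coroot (alpha i)) = 2.
Proof.
have ri := simple_root_in i.
have E := @sum_simple_refl _ (fun b => pairing b (coroot (alpha i))) i (fun b _ => pairNl b _).
have {}E : - pairing two_rho (coroot (alpha i)) = pairing two_rho (coroot (alpha i)) - 2 *+ 2.
  rewrite -[Z in Z *+ 2](pair_coroot ri) /two_rho pair_suml -E -sumrN.
  apply: eq_bigr => b _.
  by rewrite /refl pairBl pairMzl pair_coroot //; ring.
lia.
Qed.

Lemma simple_two_rho_vee i : pairing (alpha i) two_rho_vee = 2.
Proof.
have ri := simple_root_in i.
have E := @sum_simple_refl _ (fun b => pairing (alpha i) (coroot b)) i
  (fun b rb => etrans (congr1 _ (corootN rb)) (pairNr _ _)).
have {}E : - pairing (alpha i) two_rho_vee = pairing (alpha i) two_rho_vee - 2 *+ 2.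
  rewrite -[Z in Z *+ 2](pair_coroot ri) /two_rho_vee pair_sumr -E -sumrN.
  rewrite big_seq [RHS]big_seq; apply: eq_bigr => b.
  rewrite pos_rootsE => /andP[_ rb].
  by have := pair_refl (- alpha i) ri rb; rewrite raddfN /= refl_id // opprK pairNl.
lia.
Qed.

Definition in_cocone y := exists c : 'I_(ssrank D) -> nat, y = \sum_i coroot (alpha i) *+ c i.

Lemma cocone0 : in_cocone 0.
Proof. by exists (fun=> 0%N); rewrite big1. Qed.
Lemma coconeD y z : in_cocone y -> in_cocone z -> in_cocone (y + z).
Proof.
move=> [c ->] [d ->]; exists (fun i => c i + d i)%N.
by rewrite -big_split; apply: eq_bigr => i _; rewrite mulrnDr.
Qed.
Lemma cocone_simple i : in_cocone (coroot (alpha i)).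
Proof.
exists (fun j => (j == i) : nat).
by rewrite (bigD1 i) //= eqxx mulr1n big1 ?addr0 // => j /negPf ->; rewrite mulr0n.
Qed.
Lemma coconeMn y n : in_cocone y -> in_cocone (y *+ n).
Proof. by move=> py; elim: n => [|n IH]; rewrite ?mulrS //; [exact: cocone0|exact: coconeD]. Qed.

Lemma bform_sym a b : bform a b = bform b a :> int.
Proof. by apply: eq_bigr => d _; rewrite mulrC. Qed.

Lemma bform_pair a b : a \in root_seq D -> b \in root_seq D ->
  pairing b (coroot a) * bform a a = pairing a (coroot b) * bform b b.
Proof. by move=> ra rb; rewrite -!bform_root // bform_sym. Qed.

Lemma pair_gt0C a b : a \in root_seq D -> b \in root_seq D ->
  (0 < pairing a (coroot b)) = (0 < pairing b (coroot a)).
Proof.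
move=> ra rb; have := bform_pair ra rb; have := bform_gt0 ra; have := bform_gt0 rb.
by move=> pb pa E; rewrite -(pmulr_lgt0 _ pb) -E pmulr_lgt0.
Qed.

(** Induction on the height <b, 2 rho^vee>: a positive root b that is not simple has
    <b, alpha_i^vee> > 0 for some i, and s_i b is then a lower positive root whose
    coroot differs from that of b by a positive multiple of alpha_i^vee. *)
Lemma coroot_cone b : b \in root_seq D -> in_cone b -> in_cocone (coroot b).
Proof.
move=> rb pb.
have ht d e : d = \sum_i alpha i *+ e i -> pairing d two_rho_vee = (\sum_i e i * 2)%N.
  move=> ->; rewrite pair_suml -natz natr_sum; apply: eq_bigr => i _.
  by rewrite pairMnl simple_two_rho_vee natz; lia.
have [n] := ubnP `|pairing b two_rho_vee|%N.
elim: n b rb pb => // n IH b rb pb bn.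
have [[i ->]|ns] := pselect (exists i, b = alpha i); first exact: cocone_simple.
have [i bi] := root_descent rb pb; have ri := simple_root_in i.
have pr : in_cone (refl (alpha i) b).
  by apply: contraT => /(refl_simple_pos rb pb) bi'; case: ns; exists i.
have -> : coroot b = coroot (refl (alpha i) b)
    + coroot (alpha i) *~ pairing (alpha i) (coroot b).
  by rewrite /refl coroot_refl // subrK.
apply: coconeD; last first.
  rewrite (pair_gt0C rb ri) in bi; case: (pairing _ _) bi => // m _.
  by rewrite -pmulrn; exact/coconeMn/cocone_simple.
apply: (IH (refl (alpha i) b) (root_refl ri rb) pr _).
have /asboolP[c /ht cE] := pb; have /asboolP[d /ht dE] := pr.
have : pairing (refl (alpha i) b) two_rho_vee
    = pairing b two_rho_vee - pairing b (coroot (alpha i)) * 2.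
  by rewrite /refl pairBl pairMzl simple_two_rho_vee; ring.
lia.
Qed.

Lemma two_rho_cocone y : in_cocone y -> 0 <= pairing two_rho y.
Proof.
move=> [c ->]; rewrite pair_sumr; apply: sumr_ge0 => i _.
by rewrite pairMnr two_rho_simple mulrn_wge0.
Qed.

Lemma two_rho_cocone_eq0 y : in_cocone y -> pairing two_rho y = 0 -> y = 0.
Proof.
move=> [c ->]; rewrite pair_sumr => /eqP; rewrite psumr_eq0 => [/allP c0|i _]; last first.
  by rewrite pairMnr two_rho_simple mulrn_wge0.
rewrite big1 // => i _; have := c0 i (mem_index_enum _).
by rewrite pairMnr two_rho_simple /=; case: (c i) => // n; rewrite pmulrn; lia.
Qed.

Lemma coroot_neq0 a : a \in root_seq D -> coroot a != 0.
Proof.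
by move=> ra; apply/eqP => a0; have := pair_coroot ra; rewrite a0 pair0r.
Qed.

(** The sign of a root is that of a linear functional on its coroot.  This replaces
    all comparisons between the positive systems of roots and of coroots. *)
Lemma two_rho_root b : b \in root_seq D -> in_cone b = (0 < pairing two_rho (coroot b)).
Proof.
move=> rb; have P a : a \in root_seq D -> in_cone a -> 0 < pairing two_rho (coroot a).
  move=> ra pa; rewrite lt0r two_rho_cocone ?andbT; last exact: coroot_cone.
  by apply: contra (coroot_neq0 ra) => /eqP/(two_rho_cocone_eq0 (coroot_cone ra pa)) ->.
apply/idP/idP => [|lt]; first exact: P.
apply: contraT => /(root_signN rb) /(P _ (Defs.rootN rb)).
by rewrite corootN // pairNr oppr_gt0 ltNge ltW.
Qed.

Lemma two_rho_ge1 b : b \in root_seq D -> in_cone b -> 1 <= pairing two_rho (coroot b).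
Proof. by move=> rb; rewrite two_rho_root. Qed.

(** Weyl group invariants of the root lattice vanish.  If the positive part p of such
    an invariant is split off, simple roots being pairwise obtuse forces p to be
    antidominant; so <p, 2 rho^vee> <= 0, whereas this number is twice the sum of the
    coefficients of p. *)
Lemma root_lattice_invariants (c : 'I_(ssrank D) -> int) :
  (forall j, pairing (\sum_i alpha i *~ c i) (coroot (alpha j)) = 0) ->
  forall i, c i = 0.
Proof.
have S m : \sum_k alpha k *+ (k == m) = alpha m.
  by rewrite (bigD1 m) //= eqxx big1 ?addr0 // => k /negPf ->.
have obt i j : i != j -> pairing (alpha i) (coroot (alpha j)) <= 0.
  move=> ij; have ri := simple_root_in i; have rj := simple_root_in j.
  rewrite leNgt; apply/negP => ij0.
  have : in_cone (refl (alpha j) (alpha i)).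
    apply: contraT => /(refl_simple_pos ri (cone_simple i)) E.
    have S0 : \sum_k alpha k *~ ((k == i)%:Z - (k == j)%:Z) = 0.
      rewrite (eq_bigr (fun k => alpha k *+ (k == i) - alpha k *+ (k == j))).
        by rewrite sumrB !S E subrr.
      by move=> k _; rewrite mulrzBr -!pmulrn.
    by have := simple_free S0 i; rewrite eqxx (negPf ij).
  move=> /asboolP[d]; rewrite /refl; set n := pairing _ _ in ij0 * => dE.
  have S0 : \sum_k alpha k *~ ((k == i)%:Z - (k == j)%:Z * n - (d k)%:Z) = 0.
    rewrite (eq_bigr (fun k => alpha k *+ (k == i) - (alpha k *+ (k == j)) *~ n
                               - alpha k *+ d k)).
      by rewrite !sumrB -mulrz_suml !S -dE subrr.
    by move=> k _; rewrite !mulrzBr mulrzA -!pmulrn.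
  by have := simple_free S0 j; rewrite eqxx eq_sym (negPf ij); lia.
(* It suffices that the positive coefficients vanish, as - c satisfies the same
   hypothesis. *)
have main (e : 'I_(ssrank D) -> int) :
    (forall j, pairing (\sum_i alpha i *~ e i) (coroot (alpha j)) = 0) ->
    forall i, e i <= 0.
  move=> e0; pose p := \sum_i alpha i *~ Num.max 0 (e i).
  have pp j : pairing p (coroot (alpha j)) <= 0.
    have [ej|ej] := leP (e j) 0.
      rewrite pair_suml; apply: sumr_le0 => i _; rewrite pairMzl.
      have [->|ij] := eqVneq i j; first by rewrite (max_idPl ej) mulr0.
      by apply: mulr_le0_ge0; [exact: obt|rewrite le_max lexx].
    have -> : pairing p (coroot (alpha j)) =
      pairing (\sum_i alpha i *~ (Num.max 0 (e i) - e i)) (coroot (alpha j)).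
      under [in RHS]eq_bigr do rewrite mulrzBr.
      by rewrite sumrB pairBl e0 subr0.
    rewrite pair_suml; apply: sumr_le0 => i _; rewrite pairMzl.
    have [->|ij] := eqVneq i j; first by rewrite (max_idPr (ltW ej)) subrr mulr0.
    apply: mulr_le0_ge0; first exact: obt.
    by rewrite subr_ge0 le_max lexx orbT.
  have : pairing p two_rho_vee <= 0.
    rewrite /two_rho_vee pair_sumr big_seq; apply: sumr_le0 => b.
    rewrite pos_rootsE => /andP[pb rb]; have [d ->] := coroot_cone rb pb.
    rewrite pair_sumr; apply: sumr_le0 => i _; rewrite pairMnr.
    by rewrite mulrn_wle0.
  rewrite /p pair_suml => s0.
  have G i : 0 <= pairing (alpha i *~ Num.max 0 (e i)) two_rho_vee.
    by rewrite pairMzl simple_two_rho_vee; lia.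
  have : \sum_i pairing (alpha i *~ Num.max 0 (e i)) two_rho_vee == 0.
    by rewrite eq_le s0 sumr_ge0.
  rewrite psumr_eq0 // => /allP s1 i; have := s1 i (mem_index_enum _).
  by rewrite /= pairMzl simple_two_rho_vee; lia.
move=> c0 i; apply/eqP; rewrite eq_le main //=.
have := main (fun i => - c i); rewrite -oppr_le0; apply=> j.
by under eq_bigr do rewrite mulrNz; rewrite sumrN pairNl c0 oppr0.
Qed.

Lemma root_coord a : a \in root_seq D -> exists c : 'I_(ssrank D) -> int,
  a = \sum_i alpha i *~ c i.
Proof.
move=> ra; have [c [->|->]] := simple_base ra.
  by exists c; apply: eq_bigr => i _; rewrite pmulrn.
by exists (fun i => - (c i)%:Z); rewrite -sumrN; apply: eq_bigr => i _; rewrite mulrNz pmulrn.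
Qed.

(** Cauchy-Schwarz for the invariant form: the hypotheses give (a - b, a - b) <= 0, so
    a - b pairs to zero with every coroot, and it lies in the root lattice. *)
Lemma pair_two_roots a b : a \in root_seq D -> b \in root_seq D ->
  2 <= pairing a (coroot b) -> 2 <= pairing b (coroot a) -> a = b.
Proof.
move=> ra rb n2 m2.
have pa := bform_gt0 ra; have pb := bform_gt0 rb.
have Ea := bform_root b ra; have Eb := bform_root a rb.
rewrite bform_sym in Ea.
have ED : bform (a - b) (a - b) = bform a a + bform b b - bform a b *+ 2.
  rewrite /bform -sumrMnl -big_split -sumrB /=; apply: eq_bigr => d _.
  by rewrite pairBl; ring.
have D0 : bform (a - b) (a - b) <= 0 by rewrite ED; nia.
have Z d : d \in root_seq D -> pairing (a - b) (coroot d) = 0.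
  move=> rd; have : bform (a - b) (a - b) == 0.
    by rewrite eq_le D0 sumr_ge0 // => e _; rewrite -expr2 sqr_ge0.
  rewrite psumr_eq0 => [/allP/(_ d rd)/=|e _]; last by rewrite -expr2 sqr_ge0.
  by rewrite mulf_eq0 orbb => /eqP.
have [c cE] := root_coord ra; have [d dE] := root_coord rb.
have E : a - b = \sum_i alpha i *~ (c i - d i).
  by under eq_bigr do rewrite mulrzBr; rewrite sumrB -cE -dE.
apply/eqP; rewrite -subr_eq0 E big1 // => i _.
rewrite (@root_lattice_invariants (fun i => c i - d i)) ?mulr0z // => j.
by rewrite -E Z ?simple_root_in.
Qed.
End Roots.

(** * Length on the extended affine Weyl group *)

Section Length.
Variable D : based_root_datum.
Local Notation X := (wt D).
Implicit Types (a b c nu : X) (w : weyl D) (x y : ext_weyl D).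

Lemma weyl_root w b : b \in root_seq D -> w b \in root_seq D.
Proof. by move=> rb; have [s ->] := weyl_sword w; exact: sword_root. Qed.

Lemma weyl_pair w b nu : b \in root_seq D ->
  pairing (w nu) (coroot (w b)) = pairing nu (coroot b).
Proof. by move=> rb; have [s E] := weyl_sword w; rewrite !E sword_pair. Qed.

Lemma weylK w : cancel w (w^-1)%g.
Proof. exact: weylVK. Qed.

Lemma weylVKV w : cancel (w^-1)%g w.
Proof. exact: weylKV. Qed.

Lemma weyl_pairV w b nu : b \in root_seq D ->
  pairing (w nu) (coroot b) = pairing nu (coroot ((w^-1)%g b)).
Proof. by move=> rb; rewrite -[in LHS](weylVKV w b) weyl_pair ?weyl_root. Qed.

Lemma perm_weyl w : perm_eq (root_seq D) [seq w b | b <- root_seq D].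
Proof.
apply: uniq_perm; rewrite ?map_inj_uniq ?root_seq_uniq //; first exact: can_inj (weylK w).
move=> b; apply/idP/mapP => [rb|[c rc ->]]; last exact: weyl_root.
by exists ((w^-1)%g b); rewrite ?weyl_root ?weylVKV.
Qed.

Definition is_neg b : int := (~~ in_cone b)%:Z.

Lemma is_negN b : b \in root_seq D -> is_neg (- b) = 1 - is_neg b.
Proof.
move=> rb; rewrite /is_neg; have [pb|nb] := boolP (in_cone b).
  by rewrite (root_posN rb pb).
by rewrite (root_signN rb nb).
Qed.

(** The signed number of hyperplanes of direction coroot b between C and x C.  The
    last summand makes it odd in b and a cocycle in x. *)
Definition displacement x b : int :=
  pairing x.1 (coroot b) - is_neg ((x.2^-1)%g b) + is_neg b.

Lemma displacementN x b : b \in root_seq D -> displacement x (- b) = - displacement x b.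
Proof.
move=> rb; rewrite /displacement corootN // pairNr raddfN !is_negN ?weyl_root //.
ring.
Qed.

Lemma displacementM x y b : b \in root_seq D ->
  displacement (x * y)%g b = displacement x b + displacement y ((x.2^-1)%g b).
Proof.
move=> rb; rewrite /displacement /= pairDl weyl_pairV // invgM /=.
ring.
Qed.

Lemma displacement1 b : displacement 1%g b = 0.
Proof. by rewrite /displacement /= invg1 pair0l; ring. Qed.

Lemma displacementV x b : b \in root_seq D ->
  displacement (x^-1)%g b = - displacement x (x.2 b).
Proof.
move=> rb; have := displacementM (x^-1)%g x rb.
rewrite mulVg displacement1 /= invgK => /eqP; rewrite eq_sym addr_eq0 => /eqP E.
exact: E.
Qed.

Lemma displacement_transl nu b : displacement (transl nu) b = pairing nu (coroot b).
Proof. by rewrite /displacement /= invg1; ring. Qed.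

Lemma root_seq_perm : perm_eq (root_seq D) (pos_roots D ++ [seq - b | b <- pos_roots D]).
Proof.
apply: uniq_perm; first exact: root_seq_uniq.
  rewrite cat_uniq map_inj_uniq ?pos_root_seq_uniq /= ?andbT; last exact: oppr_inj.
  apply/hasPn => b /mapP[c]; rewrite !pos_rootsE => /andP[pc rc] ->.
  by rewrite (negPf (root_posN rc pc)).
move=> b; rewrite mem_cat pos_rootsE; apply/idP/orP => [rb|[/andP[]//|]].
  have [->|nb] := root_sign rb; [by left; rewrite rb|right].
  by rewrite -[b]opprK map_f // pos_rootsE nb Defs.rootN.
by move=> /mapP[c]; rewrite pos_rootsE => /andP[_ rc] ->; exact: Defs.rootN.
Qed.

(** Summing over all roots, not only the positive ones, makes the formula invariant
    under the Weyl group. *)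
Lemma double_length x : (ext_length x * 2 = \sum_(b <- root_seq D) `|displacement x b|)%N.
Proof.
have E : (ext_length x = \sum_(b <- pos_roots D) `|displacement x b|)%N.
  rewrite /ext_length big_seq [RHS]big_seq; apply: eq_bigr => b.
  rewrite pos_rootsE => /andP[pb rb]; congr absz.
  by rewrite /displacement /is_neg pb addr0.
rewrite (perm_big _ root_seq_perm) big_cat big_map -E /= muln2 -addnn; congr addn.
rewrite E big_seq [RHS]big_seq; apply: eq_bigr => b.
by rewrite pos_rootsE => /andP[_ rb]; rewrite displacementN // abszN.
Qed.

Lemma ext_length0 x : ext_length x = 0%N ->
  {in root_seq D, forall b, displacement x b = 0}.
Proof.
move=> lx b rb; have := double_length x; rewrite lx mul0n => /esym/eqP.
by rewrite (big_rem b) //= addn_eq0 absz_eq0 => /andP[/eqP].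
Qed.

Lemma ext_length_eq0 x :
  {in root_seq D, forall b, displacement x b = 0} -> ext_length x = 0%N.
Proof.
move=> x0; have := double_length x; rewrite big_seq big1; first lia.
by move=> b rb; rewrite x0.
Qed.

Lemma ext_lengthV x : ext_length (x^-1)%g = ext_length x.
Proof.
apply/eqP; rewrite -(eqn_pmul2r (isT : 0 < 2)%N) !double_length.
rewrite [in X in _ == X](perm_big _ (perm_weyl x.2)) big_map /=; apply/eqP.
rewrite big_seq [RHS]big_seq; apply: eq_bigr => b rb.
by rewrite displacementV // abszN.
Qed.

Lemma ext_length1 : ext_length (1%g : ext_weyl D) = 0%N.
Proof. by apply: ext_length_eq0 => b _; exact: displacement1. Qed.

Lemma ext_length_mul0 x y : ext_length y = 0%N -> ext_length (x * y)%g = ext_length x.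
Proof.
move=> y0; apply/eqP; rewrite -(eqn_pmul2r (isT : 0 < 2)%N) !double_length; apply/eqP.
rewrite big_seq [RHS]big_seq; apply: eq_bigr => b rb.
by rewrite displacementM // (ext_length0 y0) ?addr0 // weyl_root.
Qed.

Lemma highest_coroot_pos b : highest_coroot b -> in_cone b.
Proof.
move=> [rb max_b]; apply: contraT => /(root_signN rb) pNb.
have [d dE] := coroot_cone (Defs.rootN rb) pNb.
have E : - b = b.
  apply: (max_b _ (fun i => d i * 2)%N (Defs.rootN rb)).
  under eq_bigr do rewrite mulrnA; rewrite sumrMnl -dE corootN //.
  by rewrite mulr2n addrA subrr sub0r.
have := pair_coroot rb; rewrite -[X in pairing X _]E pairNl pair_coroot //.
Qed.

End Length.

(** * Simple affine reflections and reduced decompositions *)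

Section AffineReflections.
Variable D : based_root_datum.
Local Notation X := (wt D).
Local Notation alpha := (@simple_root D).
Implicit Types (a b c nu : X) (w : weyl D) (x y : ext_weyl D).

Lemma highest_coroot_max t b (y : cowt D) : highest_coroot t -> b \in root_seq D ->
  in_cocone y -> coroot b = coroot t + y -> b = t.
Proof. by move=> [rt max_t] rb [c ->]; exact: max_t. Qed.

(** For a highest coroot t^vee and a positive root b other than t, <t, b^vee> is 1 if
    s_t sends b to a negative root, and 0 otherwise.  A negative value would make s_t b
    at least as high as t.  For a value n > 0, s_t b is negative because b is not above t.
    If n >= 2, then <b, t^vee> = 1, so that both b and c = - s_t b are
    strictly below t; but b^vee + c^vee = n t^vee. *)
Lemma highest_coroot_pair t b : highest_coroot t -> b \in root_seq D -> in_cone b ->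
  b != t -> pairing t (coroot b) = is_neg (refl t b).
Proof.
move=> ht rb pb bt; have rt : t \in root_seq D by case: ht.
have pt := highest_coroot_pos ht.
have max_t := highest_coroot_max ht.
set n := pairing t (coroot b); set c := refl t b.
have rc : c \in root_seq D by exact: root_refl.
have cE : coroot c = coroot b - coroot t *~ n by exact: coroot_refl.
have ct : in_cocone (coroot t) by exact: coroot_cone.
have cb : in_cocone (coroot b) by exact: coroot_cone.
have [n0|n0|n0] := ltgtP n 0.
- have E : c = t.
    apply: (max_t _ (coroot b + coroot t *+ `|n|.-1) rc).
      by apply: coconeD => //; exact: coconeMn.
    rewrite cE addrCA -mulrS; congr (_ + _); rewrite -mulrNz pmulrn; congr (_ *~ _).
    by move: n0; clear; lia.
  have := reflK rt b; rewrite -/c E refl_id // => bE.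
  by have := root_posN rt pt; rewrite bE pb.
- have nC : in_cone c = false.
    apply/negP => pc; case/eqP: bt.
    apply: (max_t _ (coroot t *+ `|n|.-1 + coroot c) rb).
      by apply: coconeD; [exact: coconeMn|exact: coroot_cone].
    have nE : coroot t *~ n = coroot t *+ `|n|.-1.+1.
      by rewrite pmulrn; congr (_ *~ _); move: n0; clear; lia.
    by rewrite addrA -mulrS cE -nE addrC subrK.
  have pc : in_cone (- c) by apply: root_signN; rewrite // nC.
  rewrite /is_neg nC /=; apply/eqP; rewrite eq_le; apply/andP; split; last lia.
  rewrite leNgt; apply/negP => n2.
  have m0 : 0 < pairing b (coroot t) by rewrite (pair_gt0C rb rt).
  have m1 : pairing b (coroot t) = 1.
    apply/eqP; rewrite eq_le; apply/andP; split; last lia.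
    rewrite leNgt; apply/negP => m2; case/eqP: bt.
    by apply: pair_two_roots => //; lia.
  (* s_e t^vee = t^vee - e^vee is a coroot, positive by maximality of t. *)
  have below e : e \in root_seq D -> in_cone e -> e != t -> pairing e (coroot t) = 1 ->
      0 < pairing (two_rho D) (coroot t) - pairing (two_rho D) (coroot e).
    move=> re pe et e1; have rd : refl e t \in root_seq D by exact: root_refl.
    have dE : coroot (refl e t) = coroot t - coroot e.
      by rewrite /refl coroot_refl // e1 mulr1z.
    rewrite -pairBr -dE -two_rho_root //; apply: contraT => /(root_signN rd) nd.
    case/eqP: et; apply: (max_t _ (coroot (- refl e t)) re).
      by apply: coroot_cone; rewrite ?Defs.rootN.
    by rewrite corootN // dE opprB addrC subrK.
  have := below b rb pb bt m1.
  have := below (- c) (Defs.rootN rc) pc.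
  have -> : pairing (- c) (coroot t) = 1.
    by rewrite /c /refl pairNl pairBl pairMzl pair_coroot // m1.
  rewrite corootN // cE pairNr pairBr pairMzr.
  have -> : - c != t.
    apply: contra_neq bt => cN; have := reflK rt b.
    by rewrite -/c -[c]opprK cN raddfN /= refl_id // opprK => ->.
  move=> /(_ isT erefl); move: pt; rewrite two_rho_root //.
  move: (pairing _ (coroot t)) (pairing _ (coroot b)) n2 => h k; nia.
- have E : c = b by apply: coroot_inj; rewrite // cE n0 mulr0z subr0.
  by rewrite E /is_neg pb.
Qed.

Lemma simple_affine_root a : simple_affine a -> a \in root_seq D.
Proof.
move=> [[i ->]|[ra _]]; first exact: simple_root_in.
by rewrite -[a]opprK Defs.rootN.
Qed.

Lemma wreflE a : a \in root_seq D -> wrefl a =1 refl a.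
Proof. by move=> ra x; rewrite /wrefl /= ra. Qed.

Lemma wreflV a : a \in root_seq D -> ((wrefl a)^-1)%g = wrefl a.
Proof.
move=> ra; apply: weylP => x; apply: (can_inj (weylK (wrefl a))).
by rewrite weylVKV !wreflE // reflK.
Qed.

Lemma affine_reflV a : simple_affine a -> ((affine_refl a)^-1)%g = affine_refl a.
Proof.
move=> sa; have ra := simple_affine_root sa.
rewrite -[LHS]/(- ((affine_refl a).2^-1)%g (affine_refl a).1, ((affine_refl a).2^-1)%g).
rewrite /= wreflV // wreflE // /affine_refl; congr (_, _).
by case: ifP => _; rewrite ?raddf0 ?oppr0 // raddfN /= refl_id // opprK.
Qed.

(** A simple affine reflection moves C across one hyperplane only. *)
Lemma affine_refl_displacement a b : simple_affine a -> b \in root_seq D ->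
  displacement (affine_refl a) b = (b == - a)%:Z - (b == a)%:Z.
Proof.
move=> sa rb; have ra := simple_affine_root sa.
wlog pb : b rb / in_cone b.
  move=> pos; have [|nb] := root_sign rb; first exact: pos.
  have := pos _ (Defs.rootN rb) nb; rewrite displacementN // eqr_opp eqr_oppLR.
  lia.
rewrite /displacement /= wreflV // wreflE // [is_neg b]/is_neg pb addr0.
have aNa : a != - a.
  apply/eqP => E; have := pair_coroot ra.
  by rewrite [X in pairing X _]E pairNl pair_coroot.
case: sa => [[i aE]|ht].
  rewrite aE cone_simple pair0l sub0r.
  have -> : (b == - alpha i) = false.
    apply/eqP => bE; have := root_posN (simple_root_in i) (cone_simple i).
    by rewrite -bE pb.
  have [->|bi] := eqVneq b (alpha i).
    by rewrite refl_id ?simple_root_in // is_negN ?simple_root_in // /is_neg cone_simple.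
  rewrite /is_neg; case: (boolP (in_cone _)) => // /(refl_simple_pos rb pb) bE.
  by rewrite bE eqxx in bi.
have pa := highest_coroot_pos ht.
have na : in_cone a = false.
  by apply/negbTE; rewrite -[a]opprK root_posN // Defs.rootN.
have -> : (b == a) = false by apply/eqP => bE; rewrite bE na in pb.
rewrite na -(reflN ra) subr0.
have [->|bt] := eqVneq b (- a).
  have rNa := Defs.rootN ra.
  by rewrite pair_coroot // refl_id // is_negN // /is_neg pa.
by rewrite highest_coroot_pair // subrr.
Qed.

(** By the cocycle relation, the displacements of x s_a and x differ only in the
    directions of x.2 a and - x.2 a. *)
Lemma ext_length_mul_affine x a : simple_affine a ->
  (ext_length (x * affine_refl a)%g)%:Z
    = (ext_length x)%:Z + (if 0 < displacement x (x.2 a) then -1 else 1).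
Proof.
move=> sa; have ra := simple_affine_root sa; have rNa := Defs.rootN ra.
have aNa : - a != a.
  apply/eqP => E; have := pair_coroot ra.
  by rewrite -[X in pairing X _]E pairNl pair_coroot.
have rxa := weyl_root x.2 ra.
have S (F : X -> nat) : (\sum_(b <- root_seq D) F b = F (x.2 a) + (F (- x.2 a)
    + \sum_(b <- root_seq D | (b != a) && (b != - a)%R) F (x.2 b)))%N.
  rewrite (perm_big _ (perm_weyl x.2)) big_map (bigD1_seq a) ?root_seq_uniq //=.
  rewrite -big_filter (bigD1_seq (- a)) ?filter_uniq ?root_seq_uniq ?mem_filter ?aNa //=.
  by rewrite raddfN big_filter_cond.
have := double_length x; have := double_length (x * affine_refl a)%g.
have xE b : b \in root_seq D -> displacement (x * affine_refl a)%g (x.2 b)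
    = displacement x (x.2 b) + ((b == - a)%:Z - (b == a)%:Z).
  by move=> rb; rewrite displacementM ?weyl_root // weylK affine_refl_displacement.
rewrite !S -raddfN !xE //= !eqxx eq_sym (negPf aNa) [x.2 (- a)]raddfN displacementN //=.
rewrite (_ : \sum_(b <- _ | _) `|displacement (_ * _)%g _| =
  \sum_(b <- root_seq D | (b != a) && (b != - a)%R) `|displacement x (x.2 b)|)%N.
  move: (displacement _ _) (\sum_(b <- _ | _) _)%N => k m; case: ifP; lia.
rewrite big_seq_cond [RHS]big_seq_cond; apply: eq_bigr => b /and3P[rb ba bNa].
by rewrite xE // (negPf ba) (negPf bNa) addr0.
Qed.

Lemma ext_length_affine_mul x a : simple_affine a ->
  (ext_length (affine_refl a * x)%g)%:Z
    = (ext_length x)%:Z + (if displacement x a < 0 then -1 else 1).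
Proof.
move=> sa; have ra := simple_affine_root sa.
rewrite -ext_lengthV invgM affine_reflV // ext_length_mul_affine // ext_lengthV.
by rewrite displacementV ?weyl_root //= weylVKV oppr_gt0.
Qed.

(** Ascent in the dominance order raises the value of 2 rho, which is bounded on the
    finite set of coroots. *)
Lemma highest_coroot_above b : b \in root_seq D ->
  exists2 t, highest_coroot t & in_cocone (coroot t - coroot b).
Proof.
move=> rb.
have [M MP] : exists M : int, forall c, c \in root_seq D -> pairing (two_rho D) (coroot c) <= M.
  exists (\sum_(c <- root_seq D) `|pairing (two_rho D) (coroot c)|) => c rc.
  rewrite (bigD1_seq c) ?root_seq_uniq //=.
  by apply: ler_wpDr; [exact: sumr_ge0|exact: ler_norm].
have [n] := ubnP `|M - pairing (two_rho D) (coroot b)|%N.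
elim: n b rb => // n IH b rb bn.
have [|nmax] := pselect (highest_coroot b).
  by exists b => //; rewrite subrr; exact: cocone0.
have [c [d [rc cE cb]]] : exists c (d : 'I_(ssrank D) -> nat), [/\ c \in root_seq D,
    coroot c = coroot b + \sum_i coroot (alpha i) *+ d i & c <> b].
  apply: contrapT => no; apply: nmax; split=> // c d rc cE.
  by apply: contrapT => cb; apply: no; exists c, d.
have dC : in_cocone (\sum_i coroot (alpha i) *+ d i) by exists d.
have lt : 0 < pairing (two_rho D) (\sum_i coroot (alpha i) *+ d i).
  rewrite lt0r two_rho_cocone // andbT; apply/eqP => /(two_rho_cocone_eq0 dC) d0.
  by apply: cb; apply: coroot_inj; rewrite // cE d0 addr0.
have [|t ht tc] := IH c rc.
  have := MP c rc; rewrite cE pairDr; move: lt bn; lia.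
exists t => //; rewrite (_ : _ - _ = coroot t - coroot c + (coroot c - coroot b)).
  by apply: coconeD; rewrite // cE addrAC subrr add0r.
by rewrite addrA subrK.
Qed.

(** Otherwise x C lies on the same side as C of each wall of C, and then x has length
    0.  Indeed, for M large, the point M^-1 2 rho lies inside C, and x maps it to M^-1
    times M x.1 + x.2 (2 rho).  This image is in C as soon as it is on the right side
    of the walls of C, because every positive coroot lies between 0 and a highest
    coroot. *)
Lemma left_descent x : (0 < ext_length x)%N ->
  exists2 a, simple_affine a & (ext_length (affine_refl a * x)%g).+1 = ext_length x.
Proof.
move=> lx.
suff [a sa xa] : exists2 a, simple_affine a & displacement x a < 0.
  exists a => //; have := ext_length_affine_mul x sa; rewrite xa; lia.
apply: contrapT => no.
have pos a : simple_affine a -> 0 <= displacement x a.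
  by move=> sa; rewrite leNgt; apply/negP => xa; apply: no; exists a.
suff x0 : {in root_seq D, forall b, displacement x b = 0}.
  by rewrite ext_length_eq0 in lx.
have [M MP] : exists M : int, forall c, c \in root_seq D -> pairing (two_rho D) (coroot c) < M.
  exists (\sum_(c <- root_seq D) `|pairing (two_rho D) (coroot c)| + 1) => c rc.
  rewrite ltzD1 (bigD1_seq c) ?root_seq_uniq //=.
  by apply: ler_wpDr; [exact: sumr_ge0|exact: ler_norm].
(* F is M times the value of a linear form at the image point, so that 0 < F < M
   on a positive coroot means that no hyperplane of this direction is crossed. *)
pose F (y : cowt D) := pairing (x.1 *~ M + x.2 (two_rho D)) y.
have FE c : c \in root_seq D -> in_cone c ->
    (0 <= displacement x c) = (0 < F (coroot c)) /\
    (displacement x c <= 0) = (F (coroot c) < M).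
  move=> rc pc; rewrite /F pairDl pairMzl weyl_pairV //.
  have rv : (x.2^-1)%g c \in root_seq D by exact: weyl_root.
  rewrite /displacement [is_neg c]/is_neg pc addr0.
  have := MP _ rv; have := MP _ (Defs.rootN rv); rewrite corootN // pairNr.
  have : pairing (two_rho D) (coroot ((x.2^-1)%g c)) != 0.
    have := two_rho_root rv; have := two_rho_root (Defs.rootN rv).
    rewrite corootN // pairNr; have [->|->] := root_sign rv; lia.
  rewrite /is_neg (two_rho_root rv).
  move: (pairing x.1 _) (pairing (two_rho D) _) => k h.
  move=> hn0 h1 h2.
  have [k1|k0|k1] : [\/ k <= -1, k = 0 | 1 <= k] by case: (ltrgtP k 0); [constructor 1|constructor 3|constructor 2]; lia.
  - have : k * M <= - M by nia.
    by case: (ltrP 0 h) => h0 /=; split; apply/idP/idP; lia.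
  - by rewrite k0 mul0r; case: (ltrP 0 h) => h0 /=; split; apply/idP/idP; lia.
  - have [->|k2] : k = 1 \/ 2 <= k by lia.
      by rewrite mul1r; case: (ltrP 0 h) => h0 /=; split; apply/idP/idP; lia.
    have : 2 * M <= k * M by nia.
    by case: (ltrP 0 h) => h0 /=; split; apply/idP/idP; lia.
have Fsimple i : 0 < F (coroot (alpha i)).
  have [<- _] := FE _ (simple_root_in i) (cone_simple i).
  by apply: pos; left; exists i.
have Fcone (y : cowt D) : in_cocone y -> 0 <= F y.
  move=> [c ->]; rewrite /F pair_sumr; apply: sumr_ge0 => i _.
  by rewrite pairMnr mulrn_wge0 // ltW // Fsimple.
suff P b : b \in root_seq D -> in_cone b -> displacement x b = 0.
  move=> b rb; have [/(P _ rb)//|/(P _ (Defs.rootN rb))] := root_sign rb.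
  by rewrite displacementN // => /eqP; rewrite oppr_eq0 => /eqP.
move=> rb pb; have [Fb1 Fb2] := FE _ rb pb.
have [t ht tb] := highest_coroot_above rb.
have rt : t \in root_seq D by case: ht.
have [_ Ft] := FE _ rt (highest_coroot_pos ht).
have Ft' : F (coroot t) < M.
  rewrite -Ft -oppr_ge0 -displacementN //; apply: pos; right.
  by rewrite opprK.
apply/eqP; rewrite eq_le Fb1 Fb2; apply/andP; split.
  by apply: le_lt_trans Ft'; rewrite -subr_ge0 /F -pairBr; exact: Fcone.
rewrite lt0r Fcone ?andbT; last exact: coroot_cone.
apply: contra (coroot_neq0 rb); have [c ->] := coroot_cone rb pb.
rewrite /F pair_sumr psumr_eq0 => [/allP c0|i _]; last first.
  by rewrite pairMnr mulrn_wge0 // ltW // Fsimple.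
rewrite big1 // => i _; have := c0 i (mem_index_enum _); have := Fsimple i.
rewrite pairMnr -/(F _) mulrn_eq0; case: (c i) => //= n.
by rewrite lt0r => /andP[/negPf ->].
Qed.
End AffineReflections.

(** * Exponents of q *)

Section Heights.
Variable D : based_root_datum.
Local Notation X := (wt D).
Implicit Types (x y nu mu : X).

(** Twice rho_ad is the restriction of a linear form defined on all of X, on which
    identities between exponents are easily compared. *)
Lemma rho_ad_two_rho_vee nu : in_cone nu ->
  pairing nu (two_rho_vee D) = (`|rho_ad nu| * 2)%N.
Proof.
move=> /asboolP[c ->]; rewrite rho_ad_cone pair_suml absz_nat big_distrl /= -natz natr_sum.
by apply: eq_bigr => i _; rewrite pairMnl simple_two_rho_vee natz; lia.
Qed.

Lemma abs_rho_adD x y : in_cone x -> in_cone y ->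
  (`|rho_ad (x + y)| = `|rho_ad x| + `|rho_ad y|)%N.
Proof.
move=> px py; have := rho_ad_two_rho_vee (coneD px py).
have := rho_ad_two_rho_vee px; have := rho_ad_two_rho_vee py.
rewrite pairDl; lia.
Qed.

(** The exponent n(nu) of the twist q^n(nu) e^nu. *)
Definition twist_exp nu : nat := `|rho_ad (nu - anti nu)|%N.

Definition twist_defect nu mu : nat := `|rho_ad (anti (nu + mu) - (anti nu + anti mu))|%N.

Lemma twist_expD nu mu : (twist_exp nu + twist_exp mu = twist_defect nu mu + twist_exp (nu + mu))%N.
Proof.
have := rho_ad_two_rho_vee (antiD_ge nu mu); have := rho_ad_two_rho_vee (anti_le nu).
have := rho_ad_two_rho_vee (anti_le mu); have := rho_ad_two_rho_vee (anti_le (nu + mu)).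
rewrite -!/(twist_exp _) -/(twist_defect _ _) !pairBl !pairDl; lia.
Qed.
End Heights.

(** * Linear combinations of a family *)

Section Lincomb.
Variables (R : nzRingType) (K : choiceType).
Implicit Types (c d : {malg R[K]}).

Definition lincomb (V : lmodType R) (F : K -> V) c : V := \sum_(k <- msupp c) c@_k *: F k.

Lemma lincombEw (V : lmodType R) (F : K -> V) c (s : {fset K}) :
  (msupp c `<=` s)%fset -> lincomb F c = \sum_(k <- s) c@_k *: F k.
Proof.
move=> le; rewrite /lincomb (big_fset_incl _ le) //= => k _.
by rewrite -mcoeff_eq0 => /eqP ->; rewrite scale0r.
Qed.

Lemma lincomb_is_linear (V : lmodType R) (F : K -> V) : linear (lincomb F).
Proof.
move=> p c d; set s := (msupp c `|` msupp d)%fset.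
have le : (msupp (p *: c + d) `<=` s)%fset.
  apply: fsubset_trans (msuppD_le _ _) _.
  by rewrite fsetSU ?msuppZ_le.
rewrite (lincombEw _ le) (@lincombEw _ F c s) ?fsubsetUl // (@lincombEw _ F d s) ?fsubsetUr //.
rewrite scaler_sumr -big_split; apply: eq_bigr => k _ /=.
by rewrite mcoeffD mcoeffZ scalerDl scalerA.
Qed.
HB.instance Definition _ (V : lmodType R) (F : K -> V) :=
  GRing.isLinear.Build R {malg R[K]} V *:%R (lincomb F) (lincomb_is_linear F).

Lemma lincombU (V : lmodType R) (F : K -> V) p k : lincomb F << p *g k >> = p *: F k.
Proof. by rewrite (@lincombEw _ F _ [fset k]%fset) ?msuppU_le // big_seq_fset1 mcoeffUU. Qed.

Lemma eq_lincomb (V : lmodType R) (F G : K -> V) : F =1 G -> lincomb F =1 lincomb G.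
Proof. by move=> FG c; apply: eq_bigr => k _; rewrite FG. Qed.

Lemma lincomb_comp (V W : lmodType R) (f : V -> W) (F : K -> V) : linear f ->
  forall c, f (lincomb F c) = lincomb (f \o F) c.
Proof.
move=> fl c.
pose f' : {linear V -> W} := HB.pack f (GRing.isLinear.Build R V W *:%R f fl).
rewrite -[f]/(f' : _ -> _) linear_sum; apply: eq_bigr => k _.
by rewrite linearZ.
Qed.

Lemma lincomb_inj (V : lmodType R) (F : K -> V) :
  (forall c, lincomb F c = 0 -> c = 0) -> injective (lincomb F).
Proof.
move=> F0 c d cd; apply/eqP; rewrite -subr_eq0; apply/eqP/F0.
by rewrite linearB /= cd subrr.
Qed.
End Lincomb.

(** * The Bernstein elements of translations *)

Section Hecke.
Variable D : based_root_datum.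
Variable H : iwahori_hecke_algebra D.
Local Notation X := (wt D).
Local Notation alpha := (@simple_root D).
Local Notation T := (hecke_T H).
Local Notation E nu := (bernstein H (transl nu)).
Implicit Types (a b nu mu lam : X) (w : weyl D) (x y u : ext_weyl D) (h : H).

Lemma hecke_T_span h : exists c, h = lincomb T c.
Proof. by have [c [cE _]] := hecke_T_basis h; exists c. Qed.

Lemma hecke_T_free c : lincomb T c = 0 -> c = 0.
Proof.
move=> c0; have [d [_ dU]] := hecke_T_basis (0 : H).
have <- : d = c by apply: dU; rewrite -[RHS]/(lincomb T c) c0.
by apply: dU; rewrite -[RHS]/(lincomb T 0) linear0.
Qed.

Lemma hecke_q_torsion_free n h : 'X^n *: h = 0 -> h = 0.
Proof.
have [c ->] := hecke_T_span h; rewrite -linearZ => /hecke_T_free c0.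
suff -> : c = 0 by rewrite linear0.
apply/malgP => x; have := congr1 (mcoeff x) c0; rewrite mcoeffZ mcoeff0 => /eqP.
by rewrite mulf_eq0 expf_eq0 polyX_eq0 andbF => /eqP.
Qed.

(** T_1 is a left identity on each T_x, as the length of 1 is 0. *)
Lemma hecke_T1 : T 1%g = 1.
Proof.
have T1 h : T 1%g * h = h.
  have [c ->] := hecke_T_span h.
  rewrite (lincomb_comp (f := fun z => T 1%g * z)) => [|p y z]; last first.
    by rewrite mulrDr scalerAr.
  by apply: eq_lincomb => x /=; rewrite -hecke_T_mul mul1g ?ext_length1.
by rewrite -[LHS]mulr1 T1.
Qed.

Lemma ext_length_affine_refl b : simple_affine b -> ext_length (affine_refl b) = 1%N.
Proof.
move=> sb; have := ext_length_mul_affine 1%g sb.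
by rewrite mul1g displacement1 ext_length1 /=; lia.
Qed.

Lemma hecke_T_quadratic b : simple_affine b ->
  T (affine_refl b) * (T (affine_refl b) - ('X - 1)%:A) = 'X%:A.
Proof.
move=> sb; rewrite mulrBr -expr2 hecke_T_sqr // mulr_algr.
by rewrite addrK.
Qed.

(** Up to q, every T_s has the inverse T_s - (q - 1), and T_u is invertible for u of
    length 0; the algebra has no q-torsion. *)
Lemma hecke_T_lreg x h : T x * h = 0 -> h = 0.
Proof.
have [n] := ubnP (ext_length x); elim: n x => // n IH x xn.
have [x0|x0] := posnP (ext_length x).
  move=> /(congr1 (fun z => T (x^-1)%g * z)); rewrite mulr0 mulrA -hecke_T_mul.
    by rewrite mulVg hecke_T1 mul1r.
  by rewrite mulVg ext_lengthV x0 ext_length1.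
have [a sa xa] := left_descent x0; set y := (affine_refl a * x)%g in xa.
have xE : x = (affine_refl a * y)%g.
  by rewrite /y mulgA -{1}(affine_reflV sa) mulVg mul1g.
have TE : T x = T (affine_refl a) * T y.
  by rewrite {1}xE hecke_T_mul // -xE ext_length_affine_refl // xa add1n.
rewrite TE -mulrA => /(congr1 (fun z => (T (affine_refl a) - ('X - 1)%:A) * z)).
rewrite mulr0 mulrA.
have -> : (T (affine_refl a) - ('X - 1)%:A) * T (affine_refl a) = 'X%:A.
  by rewrite -(hecke_T_quadratic sa) mulrBl mulrBr mulr_algl mulr_algr.
rewrite mulr_algl -['X]expr1 => /hecke_q_torsion_free; apply: IH.
by rewrite ltnS in xn; rewrite xa.
Qed.

Lemma reduced_decomposition_exists x :
  exists su : seq X * ext_weyl D, reduced_decomposition x su.1 su.2.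
Proof.
have [n] := ubnP (ext_length x); elim: n x => // n IH x xn.
have [x0|x0] := posnP (ext_length x).
  by exists ([::], x); split=> //=; rewrite ?big_nil ?mul1g.
have [a sa xa] := left_descent x0.
have [|[s u] [/= ss sE sl ul]] := IH (affine_refl a * x)%g; first by rewrite xa.
exists (a :: s, u); split=> //=; last by rewrite sl.
  by move=> b; rewrite inE => /predU1P[->|/ss].
by rewrite big_cons -mulgA -sE mulgA -{1}(affine_reflV sa) mulVg mul1g.
Qed.

Lemma bernstein_reduced x : exists s u,
  reduced_decomposition x s u /\ bernstein H x = oriented_product H 1%g s u.
Proof.
rewrite /bernstein; case: xgetP => [su _ sr|no]; first by exists su.1, su.2.
by have [su /no] := reduced_decomposition_exists x.
Qed.

(** Depth in the antidominant chamber.  A property is said to hold deeply if some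
    depth suffices for it; like a filter, this allows finitely many
    such properties, and their translates, to be met by one lambda. *)
Definition deep (N : nat) lam :=
  {in root_seq D, forall b, in_cone b -> pairing lam (coroot b) <= - N%:Z}.

Definition deeply (P : X -> Prop) := exists N, forall lam, deep N lam -> P lam.

Lemma deeply_exists P : deeply P -> exists lam, P lam.
Proof.
move=> [N NP]; exists (two_rho D *~ - N%:Z); apply: NP => b rb pb.
rewrite pairMzl; have := two_rho_ge1 rb pb; nia.
Qed.

Lemma deeply_imp (P Q : X -> Prop) : (forall lam, P lam -> Q lam) -> deeply P -> deeply Q.
Proof. by move=> PQ [N NP]; exists N => lam /NP /PQ. Qed.

Lemma deeplyI P Q : deeply P -> deeply Q -> deeply (fun lam => P lam /\ Q lam).
Proof.
move=> [N NP] [M MQ]; exists (N + M)%N => lam d; split; [apply: NP|apply: MQ];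
  move=> b rb pb; apply: le_trans (d b rb pb) _; lia.
Qed.

Lemma deeply_all (s : seq X) (P : X -> X -> Prop) :
  (forall nu, deeply (P nu)) -> deeply (fun lam => forall nu, nu \in s -> P nu lam).
Proof.
move=> sP; elim: s => [|nu s IH]; first by exists 0%N.
apply: deeply_imp (deeplyI (sP nu) IH) => lam [Pnu Ps] mu.
by rewrite inE => /predU1P[->|/Ps].
Qed.

Lemma deeply_shift nu P : deeply P -> deeply (fun lam => P (lam + nu)).
Proof.
move=> [N NP].
exists (N + \sum_(c <- root_seq D) `|pairing nu (coroot c)|)%N => lam d.
apply: NP => b rb pb; have := d b rb pb; rewrite pairDl (bigD1_seq b) ?root_seq_uniq //=.
lia.
Qed.

(** The bound on displacements ensures that along the whole gallery the sign of the
    displacement of lambda x in a direction is governed by lambda.  A crossing from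
    x C to x s C, s = s_b, with x.2 b positive then increases the length, and the factor
    T_s is absorbed; for the other crossings T_(lambda x) = T_(lambda x s) T_s, and the
    factor T_s - (q - 1) turns T_s into q.  The exponent n counts the latter crossings,
    whence its relation with the lengths. *)
Lemma oriented_product_deep x s u N lam :
  (forall b, b \in s -> simple_affine b) -> ext_length u = 0%N ->
  {in root_seq D, forall b, (`|displacement x b| + size s < N)%N} -> deep N lam ->
  let y := (transl lam * x)%g in let z := (y * (\prod_(b <- s) affine_refl b) * u)%g in
  exists2 n, T y * oriented_product H x s u = 'X^n *: T z &
    (ext_length z + n * 2 = ext_length y + size s)%N.
Proof.
move=> + u0 + dl; elim: s x => [|b s IH] x ss xN y z.
  exists 0%N; last by rewrite /z big_nil mulg1 ext_length_mul0 //= muln0.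
  by rewrite expr0 scale1r /z big_nil mulg1 /= -hecke_T_mul // ext_length_mul0 // u0 addn0.
have sb : simple_affine b by apply: ss; rewrite mem_head.
have rb := simple_affine_root sb; have rxb : x.2 b \in root_seq D by exact: weyl_root.
have {}ss c : c \in s -> simple_affine c by move=> cs; apply: ss; rewrite inE cs orbT.
have xN' : {in root_seq D, forall c, (`|displacement (x * affine_refl b)%g c| + size s < N)%N}.
  move=> c rc; have := xN c rc; rewrite displacementM //= affine_refl_displacement ?weyl_root //.
  by case: (_ == _) (_ == _) => [] [] /=; lia.
have [n En Ln] := IH _ ss xN'; set y' := (transl lam * (x * affine_refl b))%g in En Ln.
have y'E : y' = (y * affine_refl b)%g by rewrite /y' mulgA.
have zE : z = (y' * (\prod_(b <- s) affine_refl b) * u)%g by rewrite /z big_cons y'E !mulgA.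
rewrite -zE in En Ln.
have yE : y = (y' * affine_refl b)%g by rewrite y'E -mulgA -{1}(affine_reflV sb) mulVg mulg1.
have Ly := ext_length_mul_affine y sb; rewrite -y'E in Ly.
have dy : displacement y (y.2 b) = pairing lam (coroot (x.2 b)) + displacement x (x.2 b).
  rewrite -[y.2 b]/(x.2 b) displacementM // displacement_transl.
  by rewrite [X in displacement x X](_ : _ = x.2 b) //= invg1.
have xNb := xN _ rxb; have ls := ext_length_affine_refl sb.
rewrite /=; case: ifP => pxb.
  have neg : (0 < displacement y (y.2 b)) = false.
    by rewrite dy; have := dl _ rxb pxb; move: xNb => /=; lia.
  have {}Ly : ext_length y' = (ext_length y).+1.
    by apply/eqP; rewrite -eqz_nat Ly neg -addn1.
  exists n; last by rewrite Ln Ly /= addSnnS.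
  by rewrite mulrA -hecke_T_mul -?y'E // Ly ls addn1.
have neg : 0 < displacement y (y.2 b).
  have nxb := root_signN rxb (negbT pxb).
  have := dl _ (Defs.rootN rxb) nxb; rewrite corootN // pairNr dy; move: xNb => /=; lia.
have {}Ly : ext_length y = (ext_length y').+1.
  by apply/eqP; rewrite -eqz_nat -addn1 PoszD Ly neg subrK.
exists n.+1; first last.
  by rewrite Ly /= mulSn addnCA Ln addSn addnS.
have -> : T y = T y' * T (affine_refl b) by rewrite -hecke_T_mul -?yE // Ly ls addn1.
rewrite -mulrA [X in _ * X]mulrA hecke_T_quadratic // mulr_algl -scalerAr En scalerA.
by rewrite -exprS.
Qed.

Lemma ext_length_transl_weyl w nu : ext_length (transl (w nu)) = ext_length (transl nu).
Proof.
apply/eqP; rewrite -(eqn_pmul2r (isT : 0 < 2)%N) !double_length; apply/eqP.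
rewrite (perm_big _ (perm_weyl w)) big_map /= big_seq [RHS]big_seq.
by apply: eq_bigr => b rb; rewrite !displacement_transl weyl_pair.
Qed.

Lemma ext_length_antidominant nu :
  {in root_seq D, forall b, in_cone b -> pairing nu (coroot b) <= 0} ->
  (ext_length (transl nu))%:Z = - pairing nu (two_rho_vee D).
Proof.
move=> anu; rewrite /ext_length /two_rho_vee pair_sumr -sumrN -natz natr_sum.
rewrite big_seq [RHS]big_seq; apply: eq_bigr => b; rewrite pos_rootsE => /andP[pb rb].
by rewrite /= invg1 /= pb natz; have := anu b rb pb; lia.
Qed.

Lemma antidominant_pos_root nu : antidominant nu ->
  {in root_seq D, forall b, in_cone b -> pairing nu (coroot b) <= 0}.
Proof.
move=> anu b rb pb; have [c ->] := coroot_cone rb pb.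
by rewrite pair_sumr; apply: sumr_le0 => i _; rewrite pairMnr mulrn_wle0.
Qed.

Lemma ext_length_transl nu :
  (ext_length (transl nu))%:Z = - pairing (anti nu) (two_rho_vee D).
Proof.
have [anu [w wE]] := antiP nu.
by rewrite -(ext_length_transl_weyl w) -wE ext_length_antidominant //; exact: antidominant_pos_root.
Qed.

Lemma translD lam nu : transl (lam + nu) = (transl lam * transl nu)%g.
Proof. by rewrite -[RHS]/(lam + nu, 1 * 1)%g mul1g. Qed.

(** Once lambda and lambda + nu are antidominant, their lengths are linear, and the
    number of factors q is (l(nu) + <nu, 2 rho^vee>) / 2 = <nu - nu_-, rho_ad>. *)
Lemma bernstein_deep nu :
  deeply (fun lam => T (transl lam) * E nu = 'X^(twist_exp nu) *: T (transl (lam + nu))).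
Proof.
have A : deeply (fun lam => {in root_seq D, forall b, in_cone b -> pairing lam (coroot b) <= 0}).
  by exists 0%N => lam d b rb pb; have := d b rb pb; rewrite oppr0.
have [s [u [[ss sE sl u0] ->]]] := bernstein_reduced (transl nu).
have B : deeply (deep (size s).+1) by exists (size s).+1.
apply: deeply_imp (deeplyI B (deeplyI A (deeply_shift nu A))) => lam [dl [al aln]].
have [|n] := @oriented_product_deep 1%g s u (size s).+1 lam ss u0 _ dl.
  by move=> b _; rewrite displacement1.
rewrite mulg1 -mulgA -sE.
rewrite -translD => -> L; congr (_ ^+ _ *: _).
rewrite sl in L; have := congr1 Posz L; rewrite !PoszD (ext_length_antidominant al).
rewrite (ext_length_antidominant aln) ext_length_transl pairDl.
have := rho_ad_two_rho_vee (anti_le nu); rewrite pairBl -/(twist_exp nu).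
lia.
Qed.

Lemma bernstein0 : E 0 = 1.
Proof.
have [lam lamE] := deeply_exists (bernstein_deep 0).
apply/eqP; rewrite -subr_eq0; apply/eqP/(@hecke_T_lreg (transl lam)).
rewrite mulrBr lamE mulr1 addr0 /twist_exp anti0 subr0.
have -> : rho_ad (0 : X) = 0.
  rewrite (_ : (0 : X) = \sum_(i < ssrank D) alpha i *+ 0) ?rho_ad_cone ?big1 //.
by rewrite expr0 scale1r subrr.
Qed.

Lemma bernsteinM nu mu : E nu * E mu = 'X^(twist_defect nu mu) *: E (nu + mu).
Proof.
have := deeplyI (bernstein_deep nu) (deeplyI (deeply_shift nu (bernstein_deep mu))
  (bernstein_deep (nu + mu))).
move=> /deeply_exists[lam [E1 [E2 E3]]].
apply/eqP; rewrite -subr_eq0; apply/eqP/(@hecke_T_lreg (transl lam)).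
rewrite mulrBr mulrA E1 -scalerAl E2 -scalerAr E3 !scalerA -!exprD twist_expD addrA.
by rewrite subrr.
Qed.

(** After multiplication by T_lambda, with lambda deep enough for all exponents that
    occur, a relation becomes one between distinct T_(lambda + nu). *)
Lemma bernstein_free c : lincomb (fun nu => E nu) c = 0 -> c = 0.
Proof.
move=> c0.
have [lam lamE] := deeply_exists (deeply_all (msupp c) bernstein_deep).
have : lincomb T (\sum_(nu <- msupp c) << c@_nu * 'X^(twist_exp nu) *g transl (lam + nu) >>) = 0.
  transitivity (T (transl lam) * lincomb (fun nu => E nu) c); last by rewrite c0 mulr0.
  rewrite linear_sum [Y in _ * Y]/lincomb mulr_sumr.
  rewrite big_seq [RHS]big_seq. apply: eq_bigr => nu cnu.
  by rewrite /= lincombU -scalerAr lamE // scalerA.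
move=> /hecke_T_free s0; apply/malgP => nu; rewrite mcoeff0.
have [cnu|] := boolP (nu \in msupp c); last by rewrite -mcoeff_eq0 => /eqP.
have := congr1 (mcoeff (transl (lam + nu))) s0.
rewrite mcoeff0 raddf_sum (bigD1_seq nu) ?fset_uniq //= mcoeffUU big1 => [|mu mn].
  by rewrite addr0 => /eqP; rewrite mulf_eq0 expf_eq0 polyX_eq0 andbF orbF => /eqP.
rewrite mcoeffU; case: eqP => [[/addrI nuE]|_]; last by rewrite mulr0n.
by rewrite nuE eqxx in mn.
Qed.
End Hecke.

(** * Restricted monomials on the Vinberg side *)

Section Dual.
Variable D : based_root_datum.
Local Notation X := (wt D).
Implicit Types (nu mu : X) (w : weyl D) (x y : V_rho D) (p : {poly int}).

Lemma V_rho_scaleE p x : p *: x = rho_pi (map_poly intr p) * x.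
Proof. by []. Qed.

Definition dual_monomial nu : V_rho D := rho_restrict (mexp (bernstein_exponent nu)).
Local Notation v := dual_monomial.

Lemma rho_restrict_e2 (mu : pos_root_monoid D) :
  rho_restrict (mexp (e2 mu)) = 'X^`|rho_ad mu| *: 1.
Proof.
rewrite V_rho_scaleE mulr1 /rho_restrict; apply/eqP; rewrite rho_pi_eq.
apply/asboolP; exists [:: (1, mexp mu)].
by rewrite big_seq1 mul1r /bc_relator /= /ad_to_vinberg /rho_eval !mext_mexp.
Qed.

Lemma rho_restrictM (f g : vinberg_ring D) :
  rho_restrict (f * g) = rho_restrict f * rho_restrict g.
Proof. by rewrite /rho_restrict polyCM rmorphM. Qed.

Lemma rho_restrict_mexpD (k l : vinberg_monoid D) :
  rho_restrict (mexp (k + l)) = rho_restrict (mexp k) * rho_restrict (mexp l).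
Proof.
apply: etrans (rho_restrictM _ _).
congr rho_restrict; exact: mexpD.
Qed.

Lemma rho_restrict_mexp (k : vinberg_monoid D) :
  rho_restrict (mexp k)
    = 'X^`|rho_ad ((val k).2 + anti (val k).1)| *: v (val k).1.
Proof.
have kP : (val k).2 + anti (val k).1 \in @pos_lattice D by case: k.
have kE : k = e2 (PosRoot kP) + bernstein_exponent (val k).1.
  apply: val_inj; rewrite -[RHS]/(0 + (val k).1, (val k).2 + anti (val k).1 + - anti (val k).1).
  by rewrite add0r addrK -surjective_pairing.
transitivity (rho_restrict (mexp (e2 (PosRoot kP))) * v (val k).1).
  rewrite -[RHS]rho_restrict_mexpD.
  congr (rho_restrict (mexp _)).
  exact: kE.
by rewrite rho_restrict_e2 -scalerAl mul1r.
Qed.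

Lemma dual_monomialM nu mu : v nu * v mu = 'X^(twist_defect nu mu) *: v (nu + mu).
Proof.
rewrite /dual_monomial -[LHS]rho_restrict_mexpD.
rewrite [LHS]rho_restrict_mexp.
rewrite -[val (_ + _)]/(nu + mu, - anti nu + - anti mu) [(_, _).1]/= [(_, _).2]/=.
by rewrite -opprD addrC.
Qed.

Lemma dual_monomial0 : v (0 : X) = 1.
Proof.
rewrite /dual_monomial; have -> : bernstein_exponent (0 : X) = 0 by apply: val_inj; rewrite /= anti0 oppr0.
by rewrite mexp0 /rho_restrict rmorph1.
Qed.

Lemma rho_restrict_is_additive : zmod_morphism (@rho_restrict D).
Proof. by move=> f g; rewrite /rho_restrict polyCB raddfB. Qed.

Lemma dual_monomial_span x : exists c, x = lincomb v c.
Proof.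
pose S x := exists c, x = lincomb v c.
have S0 : S 0 by exists 0; rewrite linear0.
have SZD p y z : S y -> S z -> S (p *: y + z).
  by move=> [c ->] [d ->]; exists (p *: c + d); rewrite linearP.
have SD y z : S y -> S z -> S (y + z) by rewrite -{2}[y]scale1r; exact: SZD.
have Sv nu : S (v nu) by exists << nu >>; rewrite lincombU scale1r.
have SC f : S (rho_restrict f).
  rewrite (monoid_ringE f) /mext (zmod_morphism_sum _ _ rho_restrict_is_additive).
  elim/big_ind: _ => // k _.
  rewrite (zmod_morphism_mulrz _ _ rho_restrict_is_additive) rho_restrict_mexp.
  by rewrite -scaler_int scalerA -[_ *: _]addr0; exact: SZD.
rewrite -/(S x) -(rho_pi_surj x); elim/poly_ind: (repr x) => [|q f IH].
  by rewrite raddf0.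
rewrite rmorphD rmorphM /= mulrC.
have -> : rho_pi 'X * rho_pi q = 'X *: rho_pi q :> V_rho D.
  by rewrite V_rho_scaleE map_polyX.
by apply: SZD => //; exact: SC.
Qed.

(** The image q^<nu1 + nu2, rho_ad> e^nu1 of e_1^nu1 (x) e_2^nu2.  Only nu1 + nu2 makes
    the exponent both additive in (nu1, nu2) and nonnegative: it is the sum of
    nu1 - nu1_- and nu2 + nu1_-. *)
Definition twist_monomial (k : vinberg_monoid D) : {poly (monoid_ring X)} :=
  'X^`|rho_ad ((val k).1 + (val k).2)| * (mexp (val k).1)%:P.

Lemma vinberg_cone_sum (k : vinberg_monoid D) : in_cone ((val k).1 + (val k).2).
Proof.
have kP : in_cone ((val k).2 + anti (val k).1) by rewrite -vinberg_coneE; case: k.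
have := coneD (anti_le (val k).1) kP.
by rewrite [_ + anti _]addrC addrA subrK.
Qed.

Lemma twist_monomial0 : twist_monomial 0 = 1.
Proof.
rewrite /twist_monomial /= addr0; have := abs_rho_adD (cone0 D) (cone0 D).
rewrite addr0 -[LHS]addn0 => /addnI <-.
by rewrite expr0 mul1r mexp0.
Qed.

Lemma twist_monomialD k l : twist_monomial (k + l) = twist_monomial k * twist_monomial l.
Proof.
rewrite /twist_monomial mulrACA -exprD -polyCM -mexpD -abs_rho_adD ?vinberg_cone_sum //.
rewrite /= [in RHS]addrACA; congr (_ * _).
Qed.

Definition twist : vinberg_ring D -> {poly (monoid_ring X)} := mext twist_monomial.
HB.instance Definition _ := GRing.Additive.on twist.
Lemma twist_mul : monoid_morphism twist.
Proof. exact: mext_is_multiplicative twist_monomial0 twist_monomialD. Qed.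
HB.instance Definition _ := GRing.isMonoidMorphism.Build (vinberg_ring D)
  {poly (monoid_ring X)} twist twist_mul.

(** The extension of the twist to B[q], for B the functions on V, sending q to q; it
    kills the ideal that defines the base change. *)
Definition poly_twist (P : {poly (vinberg_ring D)}) : {poly (monoid_ring X)} :=
  (map_poly twist P).['X].
Lemma poly_twist_zmod : zmod_morphism poly_twist.
Proof. by move=> P Q; rewrite /poly_twist raddfB /= hornerD hornerN. Qed.
Lemma poly_twist_mul : monoid_morphism poly_twist.
Proof.
split; first by rewrite /poly_twist rmorph1 hornerC.
by move=> P Q; rewrite /poly_twist rmorphM /= hornerM.
Qed.
HB.instance Definition _ :=
  GRing.isZmodMorphism.Build {poly (vinberg_ring D)} {poly (monoid_ring X)}
    poly_twist poly_twist_zmod.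
HB.instance Definition _ :=
  GRing.isMonoidMorphism.Build {poly (vinberg_ring D)} {poly (monoid_ring X)}
    poly_twist poly_twist_mul.

Lemma poly_twistC f : poly_twist f%:P = twist f.
Proof. by rewrite /poly_twist map_polyC hornerC. Qed.

Lemma poly_twist_int p : poly_twist (map_poly intr p) = map_poly intr p.
Proof.
rewrite /poly_twist -map_poly_comp.
have -> : map_poly (twist \o intr) p = map_poly (polyC \o intr) p.
  by apply: eq_map_poly => n /=; rewrite !rmorph_int.
by rewrite map_poly_comp -/(comp_poly _ _) comp_polyXr.
Qed.

Lemma poly_twist_relator a :
  poly_twist (ad_to_vinberg a)%:P = poly_twist (map_poly intr (rho_eval a)).
Proof.
move: a; apply: mext_unique => [a b|a b|mu].
- by rewrite raddfB polyCB raddfB.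
- by rewrite !raddfB.
rewrite poly_twistC poly_twist_int /ad_to_vinberg /rho_eval /twist !mext_mexp.
by rewrite /twist_monomial /= add0r mexp0 mulr1 /q_rho rmorphXn /= map_polyX.
Qed.

(** The coefficient in Z[q] of e^nu, after exchanging Z[X][q] with Z[q][X]. *)
Definition coef_at nu : {poly (monoid_ring X)} -> {poly int} :=
  map_poly (fun f : monoid_ring X => (f : {malg int[X]})@_nu).

Lemma coef_at_mul nu mu p :
  coef_at nu (map_poly intr p * (mexp mu)%:P) = p *+ (mu == nu).
Proof.
apply/polyP => i; rewrite coefMn coef_map_id0 ?mcoeff0 // coefMC coef_map mulrzl.
by rewrite raddfMz /= /mexp mcoeffU; case: eqP => _ /=; rewrite ?mulr1n ?mulr0n ?intz ?mul0rz.
Qed.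

Lemma dual_monomial_free c : lincomb v c = 0 -> c = 0.
Proof.
set P := \sum_(nu <- msupp c) map_poly intr c@_nu * (mexp (bernstein_exponent nu))%:P.
have -> : lincomb v c = rho_pi P.
  by rewrite /P rmorph_sum; apply: eq_bigr => nu _; rewrite V_rho_scaleE rmorphM.
move=> P0; have : P \in @rho_ideal D by rewrite -[P]subr0 -rho_pi_eq P0 raddf0.
move=> /(bc_ideal_rmorph poly_twist_relator); rewrite rmorph_sum => PT.
apply/malgP => nu; rewrite mcoeff0.
have [cnu|] := boolP (nu \in msupp c); last by rewrite -mcoeff_eq0 => /eqP.
have := congr1 (coef_at nu) PT; rewrite /coef_at raddf_sum raddf0.
rewrite (eq_bigr (fun mu => (c@_mu * 'X^(twist_exp mu)) *+ (mu == nu))) => [|mu _].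
  rewrite (bigD1_seq nu) ?fset_uniq //= eqxx big1 => [|mu /negPf ->]; last by rewrite mulr0n.
  by rewrite addr0 => /eqP; rewrite mulf_eq0 expf_eq0 polyX_eq0 andbF orbF => /eqP.
rewrite -coef_at_mul /coef_at; congr (map_poly _ _).
rewrite rmorphM /= poly_twist_int poly_twistC /twist mext_mexp /twist_monomial /=.
by rewrite mulrA -/(twist_exp _) !rmorphM /= rmorphXn /= map_polyX.
Qed.

Lemma V_rho_act_linear w : linear (V_rho_act w).
Proof.
move=> p x y.
have actp : map_poly (vinberg_act w) (map_poly intr p) = map_poly intr p.
  by rewrite -map_poly_comp; apply: eq_map_poly => n /=; rewrite rmorph_int.
rewrite -(rho_pi_surj x) -(rho_pi_surj y) V_rho_scaleE -rmorphM -rmorphD !V_rho_actE.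
rewrite (rmorphD (map_poly (vinberg_act w))) (rmorphM (map_poly (vinberg_act w))) /= actp.
by rewrite V_rho_scaleE rmorphD rmorphM.
Qed.

Lemma V_rho_act1 w : V_rho_act w 1 = 1 :> V_rho D.
Proof. by rewrite -(rmorph1 (@rho_pi D)) V_rho_actE !rmorph1. Qed.

Lemma V_rho_actM w x y : V_rho_act w (x * y) = V_rho_act w x * V_rho_act w y.
Proof.
by rewrite -(rho_pi_surj x) -(rho_pi_surj y) -rmorphM !V_rho_actE !rmorphM.
Qed.

Lemma V_rho_act_monomial w nu : V_rho_act w (v nu) = v (w nu).
Proof.
rewrite /dual_monomial /rho_restrict V_rho_actE map_polyC /= /vinberg_act mext_mexp.
by congr (rho_pi (mexp _)%:P); apply: val_inj; rewrite /= anti_weyl.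
Qed.
End Dual.

(** * The isomorphism *)

Section Assembly.
Variable D : based_root_datum.
Local Notation X := (wt D).
Implicit Types (c d : {malg {poly int}[X]}) (w : weyl D).

(** The product of Z[q][X] for which e^nu stands for q^n(nu) e^nu. *)
Definition twisted_mul c d : {malg {poly int}[X]} :=
  lincomb (fun nu => lincomb (fun mu => << 'X^(twist_defect nu mu) *g nu + mu >>) d) c.

Lemma lincombM (A : algType {poly int}) (F : X -> A) c d :
  (forall nu mu, F nu * F mu = 'X^(twist_defect nu mu) *: F (nu + mu)) ->
  lincomb F c * lincomb F d = lincomb F (twisted_mul c d).
Proof.
move=> FM; rewrite /twisted_mul (lincomb_comp (f := lincomb F)); last exact: linearP.
rewrite (lincomb_comp (f := fun z => z * lincomb F d)) => [|p y z]; last first.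
  by rewrite mulrDl scalerAl.
apply: eq_lincomb => nu /=; rewrite (lincomb_comp (f := lincomb F)); last exact: linearP.
rewrite (lincomb_comp (f := fun z => F nu * z)) => [|p y z]; last first.
  by rewrite mulrDr scalerAr.
by apply: eq_lincomb => mu /=; rewrite lincombU FM.
Qed.

Definition permute_exponents w c : {malg {poly int}[X]} := lincomb (fun nu => << w nu >>) c.

Lemma lincomb_permute (A : lmodType {poly int}) (F : X -> A) w c :
  lincomb F (permute_exponents w c) = lincomb (fun nu => F (w nu)) c.
Proof.
rewrite /permute_exponents (lincomb_comp (f := lincomb F)); last exact: linearP.
by apply: eq_lincomb => nu /=; rewrite lincombU scale1r.
Qed.

End Assembly.

Theorem proposition5p4p3 (D : based_root_datum) (H : iwahori_hecke_algebra D) :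
  exists B : H -> V_rho D,
    [/\ forall nu : wt D,
          B (bernstein H (transl nu)) = rho_restrict (mexp (bernstein_exponent nu)),
        is_algebra_iso (bernstein_subalgebra H) setT B,
        forall (w : weyl D) (a : H), bernstein_subalgebra H a ->
          B (bernstein_act H w a) = V_rho_act w (B a) &
        is_algebra_iso (fixed_points (bernstein_subalgebra H) (bernstein_act H))
          (fixed_points setT V_rho_act) B].
Proof.
pose F nu := bernstein H (transl nu).
pose G := @dual_monomial D.
have injF : injective (lincomb F) := lincomb_inj (@bernstein_free D H).
have injG : injective (lincomb G) := lincomb_inj (@dual_monomial_free D).
have xgetF c : xget 0 [set d | lincomb F c = lincomb F d]%classic = c.
  by case: xgetP => [d _ /injF ->|/(_ c)/(_ erefl)].
pose B (h : H) : V_rho D := lincomb G (xget 0 [set c | h = lincomb F c]%classic).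
have BE c : B (lincomb F c) = lincomb G c by rewrite /B xgetF.
have actE w c : bernstein_act H w (lincomb F c) = lincomb F (permute_exponents w c).
  by rewrite lincomb_permute -{2}(xgetF c).
have VactE w c : V_rho_act w (lincomb G c) = lincomb G (permute_exponents w c).
  rewrite lincomb_permute (lincomb_comp (f := V_rho_act w)); last exact: V_rho_act_linear.
  by apply: eq_lincomb => nu; exact: V_rho_act_monomial.
have FM c d : lincomb F c * lincomb F d = lincomb F (twisted_mul c d).
  by apply: lincombM; exact: bernsteinM.
have GM c d : lincomb G c * lincomb G d = lincomb G (twisted_mul c d).
  by apply: lincombM; exact: dual_monomialM.
have F1 : 1 = lincomb F << 0 >> by rewrite lincombU scale1r /F bernstein0.
have G1 : 1 = lincomb G << 0 >> by rewrite lincombU scale1r /G dual_monomial0.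
have SE h : bernstein_subalgebra H h <-> exists c, h = lincomb F c.
  by split=> [[c _ <-]|[c ->]]; exists c.
have Gsurj x : exists c, x = lincomb G c by exact: dual_monomial_span.
have S1 : bernstein_subalgebra H 1 by apply/SE; exists << 0 >>.
have SL p x y : bernstein_subalgebra H x -> bernstein_subalgebra H y ->
    bernstein_subalgebra H (p *: x + y).
  by move=> /SE[c ->] /SE[d ->]; apply/SE; exists (p *: c + d); rewrite linearP.
have SM x y : bernstein_subalgebra H x -> bernstein_subalgebra H y ->
    bernstein_subalgebra H (x * y).
  by move=> /SE[c ->] /SE[d ->]; apply/SE; exists (twisted_mul c d).
have BL p x y : bernstein_subalgebra H x -> bernstein_subalgebra H y ->
    B (p *: x + y) = p *: B x + B y.
  by move=> /SE[c ->] /SE[d ->]; rewrite -linearP !BE linearP.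
have B1 : B 1 = 1 by rewrite F1 BE G1.
have BM x y : bernstein_subalgebra H x -> bernstein_subalgebra H y ->
    B (x * y) = B x * B y.
  by move=> /SE[c ->] /SE[d ->]; rewrite FM !BE GM.
have Binj x y : bernstein_subalgebra H x -> bernstein_subalgebra H y -> B x = B y -> x = y.
  by move=> /SE[c ->] /SE[d ->]; rewrite !BE => /injG ->.
have Sact w x : bernstein_subalgebra H x -> bernstein_subalgebra H (bernstein_act H w x).
  by move=> /SE[c ->]; apply/SE; rewrite actE; exists (permute_exponents w c).
have Beq w x : bernstein_subalgebra H x -> B (bernstein_act H w x) = V_rho_act w (B x).
  by move=> /SE[c ->]; rewrite actE !BE VactE.
(* Equivariance and injectivity make B detect fixed points, so the statement on
   invariants follows from the one on the whole algebras. *)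
have fixE x : bernstein_subalgebra H x ->
    (forall w, bernstein_act H w x = x) <-> (forall w, V_rho_act w (B x) = B x).
  move=> Sx; split=> fx w; first by rewrite -Beq // fx.
  by apply: Binj; rewrite ?Beq //; exact: Sact.
exists B; split=> //.
- by move=> nu; rewrite -[bernstein _ _]scale1r -(lincombU F) BE lincombU scale1r.
- split=> //; split=> //.
  + by move=> x y /set_mem Sx /set_mem Sy; exact: Binj.
  + by move=> x _; have [c ->] := Gsurj x; exists (lincomb F c); [apply/SE; exists c|exact: BE].
- have fixB x : fixed_points (bernstein_subalgebra H) (bernstein_act H) x <->
      bernstein_subalgebra H x /\ forall w, V_rho_act w (B x) = B x.
    by split=> [[Sx /(fixE _ Sx) fx]|[Sx /(fixE _ Sx) fx]].
  split=> //.
  + split; split.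
    * by apply/fixB; split=> // w; rewrite B1 V_rho_act1.
    * move=> p x y /fixB[Sx fx] /fixB[Sy fy]; apply/fixB; split; first exact: SL.
      by move=> w; rewrite BL // V_rho_act_linear fx fy.
    * move=> x y /fixB[Sx fx] /fixB[Sy fy]; apply/fixB; split; first exact: SM.
      by move=> w; rewrite BM // V_rho_actM fx fy.
    * by split=> // w; rewrite V_rho_act1.
    * by move=> p x y [_ fx] [_ fy]; split=> // w; rewrite V_rho_act_linear fx fy.
    * by move=> x y [_ fx] [_ fy]; split=> // w; rewrite V_rho_actM fx fy.
  + by move=> p x y [Sx _] [Sy _]; exact: BL.
  + by move=> x y [Sx _] [Sy _]; exact: BM.
  + split.
    * by move=> x /fixB[Sx fx]; split.
    * by move=> x y /set_mem[Sx _] /set_mem[Sy _]; exact: Binj.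
    * move=> x [_ fx]; have [c xE] := Gsurj x; exists (lincomb F c); last by rewrite BE.
      by apply/fixB; split; [apply/SE; exists c|rewrite BE -xE].
Qed.
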